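(* Let $u\in\mathcal{O}_n$ be unitary. The endomorphism $\lambda_u$ commutes with all Bogolyubov automorphisms of $\mathcal{O}_n$ if and only if $u$ is in the (norm-)closed linear span of the unitaries associated with induced permutations (of $W_n^k$, over all $k\in\mathbb{N}$).
   Context: Let $n\ge 2$ be an integer and let $\mathcal{O}_n$ be the Cuntz algebra, generated by isometries $S_1,\ldots,S_n$ with $\sum_{i=1}^n S_iS_i^*=I$. Let $W_n^k=\{1,\ldots,n\}^k$ and, for $\alpha\in W_n^k$, $S_\alpha=S_{\alpha_1}\cdots S_{\alpha_k}$; $\mathcal{F}_n^1=\operatorname{span}\{S_iS_j^*\}$. For a unitary $u\in\mathcal{O}_n$, $\lambda_u$ is the unital $*$-endomorphism of $\mathcal{O}_n$ determined by $\lambda_u(S_i)=uS_i$, $i=1,\ldots,n$. A Bogolyubov automorphism is $\lambda_z$ with $z$ a unitary in $\mathcal{F}_n^1$. A permutation $\sigma$ of $W_n^k$ is called induced if there is a permutation $\omega\in\operatorname{Sym}(k)$ with $\sigma(\alpha)=(\alpha_{\omega(1)},\ldots,\alpha_{\omega(k)})$ for all $\alpha\in W_n^k$. The unitary associated with a permutation $\sigma$ of $W_n^k$ is $\sum_{\alpha\in W_n^k}S_{\sigma(\alpha)}S_\alpha^*$. *)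

(* Defs.v *)
From HB Require Import structures.
From mathcomp Require Import all_boot all_order all_algebra all_fingroup.
From mathcomp Require Import complex.
From mathcomp Require Import all_classical all_reals all_analysis.

Set Implicit Arguments.
Unset Strict Implicit.
Unset Printing Implicit Defensive.

Import Order.TTheory GRing.Theory Num.Theory.
Import numFieldNormedType.Exports.

Local Open Scope classical_set_scope.
Local Open Scope ring_scope.

(* Unital C*-algebras: a complex Banach space with a ring structure and an
   involution. The norm of a normed module over R[i] takes its values in the
   nonnegative reals of R[i]. The carrier receives its algebra instance below;
   a direct HB join of Algebra and NormedModule is refused by the hierarchy. *)
Record cstarAlgType (R : realType) := CStarAlgType {
  cstar_space : completeNormedModType R[i];
  cstar_one : cstar_space;
  cstar_mul : cstar_space -> cstar_space -> cstar_space;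
  cstar_star : cstar_space -> cstar_space;
  cstar_mulA : associative cstar_mul;
  cstar_mul1l : left_id cstar_one cstar_mul;
  cstar_mul1r : right_id cstar_one cstar_mul;
  cstar_mulDl : left_distributive cstar_mul +%R;
  cstar_mulDr : right_distributive cstar_mul +%R;
  cstar_one_neq0 : cstar_one != 0;
  cstar_scaleAl : forall (c : R[i]) x y,
    c *: cstar_mul x y = cstar_mul (c *: x) y;
  cstar_scaleAr : forall (c : R[i]) x y,
    c *: cstar_mul x y = cstar_mul x (c *: y);
  cstar_starK : involutive cstar_star;
  cstar_starD : {morph cstar_star : x y / x + y};
  cstar_starZ : forall (c : R[i]) x, cstar_star (c *: x) = c^* *: cstar_star x;
  cstar_starM : forall x y,
    cstar_star (cstar_mul x y) = cstar_mul (cstar_star y) (cstar_star x);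
  cstar_normM : forall x y, `|cstar_mul x y| <= `|x| * `|y|;
  cstar_norm_star : forall x, `|cstar_mul (cstar_star x) x| = `|x| ^+ 2
}.

Definition cstar_sort (R : realType) (A : cstarAlgType R) : Type :=
  cstar_space A.
Coercion cstar_sort : cstarAlgType >-> Sortclass.

Section CStarInstances.
Variables (R : realType) (A : cstarAlgType R).

HB.instance Definition _ := CompleteNormedModule.on (cstar_sort A).
HB.instance Definition _ := GRing.Zmodule_isNzRing.Build (cstar_sort A)
  (@cstar_mulA R A) (@cstar_mul1l R A) (@cstar_mul1r R A)
  (@cstar_mulDl R A) (@cstar_mulDr R A) (@cstar_one_neq0 R A).
HB.instance Definition _ :=
  GRing.Lmodule_isLalgebra.Build R[i] (cstar_sort A) (@cstar_scaleAl R A).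
HB.instance Definition _ :=
  GRing.Lalgebra_isAlgebra.Build R[i] (cstar_sort A) (@cstar_scaleAr R A).
End CStarInstances.

Definition star (R : realType) (A : cstarAlgType R) (x : A) : A :=
  @cstar_star R A x.

Section CStarTheory.
Variables (R : realType) (A : cstarAlgType R).
Implicit Types (x y : A) (c : R[i]).

Lemma starK : involutive (@star R A). Proof. exact: cstar_starK. Qed.
Lemma starD : {morph @star R A : x y / x + y}. Proof. exact: cstar_starD. Qed.
Lemma starZ c x : star (c *: x) = c^* *: star x.
Proof. exact: cstar_starZ. Qed.
Lemma starM x y : star (x * y) = star y * star x.
Proof. exact: cstar_starM. Qed.
Lemma normrM_le x y : `|x * y| <= `|x| * `|y|.
Proof. exact: cstar_normM. Qed.
Lemma norm_starM x : `|star x * x| = `|x| ^+ 2.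
Proof. exact: cstar_norm_star. Qed.
End CStarTheory.

Definition unitary (R : realType) (A : cstarAlgType R) (u : A) : Prop :=
  star u * u = 1 /\ u * star u = 1.

(* {lrmorphism A -> B}: multiplicative, unital and R[i]-linear maps. *)
Definition star_preserving (R : realType) (A B : cstarAlgType R)
    (f : {lrmorphism A -> B}) : Prop :=
  forall x : A, f (star x) = star (f x).

Definition lin_span (R : realType) (A : cstarAlgType R) (D : set A) : set A :=
  [set x | exists (m : nat) (c : 'I_m -> R[i]) (d : 'I_m -> A),
    (forall i, D (d i)) /\ x = \sum_(i < m) c i *: d i].

Definition closed_lin_span (R : realType) (A : cstarAlgType R) (D : set A) :
  set A := closure (lin_span D).

Record closed_star_subalgebra (R : realType) (A : cstarAlgType R) (D : set A) :
    Prop := ClosedStarSubalgebra {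
  css_closed : closed D;
  css_1 : D 1;
  css_D : forall x y : A, D x -> D y -> D (x + y);
  css_Z : forall (c : R[i]) (x : A), D x -> D (c *: x);
  css_M : forall x y : A, D x -> D y -> D (x * y);
  css_star : forall x : A, D x -> D (star x)
}.

Definition cuntz_family (R : realType) (A : cstarAlgType R) (n : nat)
    (S : 'I_n -> A) : Prop :=
  (forall i, star (S i) * S i = 1) /\ \sum_(i < n) S i * star (S i) = 1.

(* A with S is the Cuntz algebra O_n: the universal unital C*-algebra generated
   by n isometries S_i with \sum_i S_i S_i^* = 1. *)
Record cuntz_algebra (R : realType) (A : cstarAlgType R) (n : nat)
    (S : 'I_n -> A) : Prop := CuntzAlgebra {
  cuntz_rel : cuntz_family S;
  cuntz_gen : forall D : set A,
    closed_star_subalgebra D -> (forall i, D (S i)) -> D = setT;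
  cuntz_univ : forall (B : cstarAlgType R) (T : 'I_n -> B), cuntz_family T ->
    exists f : {lrmorphism A -> B},
      [/\ star_preserving f, forall i, f (S i) = T i &
        forall g : {lrmorphism A -> B},
          star_preserving g -> (forall i, g (S i) = T i) -> g =1 f]
}.

(* f is the endomorphism lambda_u; it exists and is unique by
   cuntz_endo_exists below. *)
Definition is_cuntz_endo (R : realType) (A : cstarAlgType R) (n : nat)
    (S : 'I_n -> A) (u : A) (f : {lrmorphism A -> A}) : Prop :=
  star_preserving f /\ forall i, f (S i) = u * S i.

Lemma cuntz_endo_exists (R : realType) (A : cstarAlgType R) (n : nat)
    (S : 'I_n -> A) (u : A) : cuntz_algebra S -> unitary u ->
  exists f : {lrmorphism A -> A}, is_cuntz_endo S u f /\
    forall g : {lrmorphism A -> A}, is_cuntz_endo S u g -> g =1 f.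
Proof.
move=> [[SS sumS] _ univ] [uu1 uu2].
have fam : cuntz_family (fun i => u * S i).
  split=> [i|]; first by rewrite starM -mulrA (mulrA (star u)) uu1 mul1r SS.
  under eq_bigr => i _ do rewrite starM mulrA -(mulrA u).
  by rewrite -mulr_suml -mulr_sumr sumS mulr1.
have [f [fstar fS fU]] := univ A _ fam.
by exists f; split=> // g [gstar gS]; exact: fU.
Qed.

(* The span F_n^1 of the S_i S_j^*. *)
Definition cuntz_F1 (R : realType) (A : cstarAlgType R) (n : nat)
    (S : 'I_n -> A) : set A :=
  lin_span [set x | exists i j : 'I_n, x = S i * star (S j)].

Definition bogolyubov (R : realType) (A : cstarAlgType R) (n : nat)
    (S : 'I_n -> A) (f : {lrmorphism A -> A}) : Prop :=
  exists z : A, [/\ unitary z, cuntz_F1 S z & is_cuntz_endo S z f].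

(* S_alpha; the product is taken in the order of the letters of alpha. *)
Definition word_isometry (R : realType) (A : cstarAlgType R) (n k : nat)
    (S : 'I_n -> A) (alpha : k.-tuple 'I_n) : A :=
  \prod_(i <- alpha) S i.

Definition induced_perm (n k : nat) (sigma : {perm k.-tuple 'I_n}) : Prop :=
  exists omega : 'S_k, forall alpha : k.-tuple 'I_n,
    sigma alpha = [tuple tnth alpha (omega i) | i < k].

Definition perm_unitary (R : realType) (A : cstarAlgType R) (n k : nat)
    (S : 'I_n -> A) (sigma : {perm k.-tuple 'I_n}) : A :=
  \sum_(alpha : k.-tuple 'I_n)
    word_isometry S (sigma alpha) * star (word_isometry S alpha).

Definition induced_unitaries (R : realType) (A : cstarAlgType R) (n : nat)
    (S : 'I_n -> A) : set A :=
  [set v | exists (k : nat) (sigma : {perm k.-tuple 'I_n}),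
    induced_perm sigma /\ v = perm_unitary S sigma].

(* Main.v *)
Require Import Defs.
From HB Require Import structures.
From mathcomp Require Import all_boot all_order all_algebra all_fingroup.
From mathcomp Require Import zify ring.
From mathcomp Require Import complex.
From mathcomp Require Import all_classical all_reals all_analysis.

(* [lambda_u] commutes with all Bogolyubov automorphisms iff they all fix [u].
   Such automorphisms are contractive and fix the unitaries of induced
   permutations, which gives one direction. Conversely, a fixed [u] is close to
   a linear combination of words [S_a S_b^*]; averaging over gauge automorphisms
   removes the words with [|a| <> |b|], so [u] is close to some element of
   [span {S_a S_b^* : |a| = |b| = k}], a copy of the k-th tensor power of the
   n x n matrices on which Bogolyubov automorphisms act by conjugation with
   [z^(x)k]. Instead of integrating over the unitary group, take the element of
   least Hilbert-Schmidt norm among those within a given distance of [u]: this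
   set is convex, closed and invariant, so the minimizer is fixed, and Schur-Weyl
   duality puts it in the span of the permutations of tensor factors.
   The C*-algebra facts needed (contractivity of *-homomorphisms, orthogonality
   of the ranges of the [S_i]) are derived from one square root construction
   and from unitaries [a + i b] with [a^2 + b^2 = 1]. *)

Set Implicit Arguments.
Unset Strict Implicit.
Unset Printing Implicit Defensive.

Import Order.TTheory GRing.Theory Num.Theory.
Import numFieldNormedType.Exports.

Local Open Scope classical_set_scope.
Local Open Scope ring_scope.
Local Open Scope sesquilinear_scope.

(** * Schur-Weyl duality *)

Lemma prod_sum_tuple (R : pzSemiRingType) (n k : nat)
    (F : 'I_k -> 'I_n -> R) :
  \prod_(i < k) \sum_(j < n) F i j =
  \sum_(t : k.-tuple 'I_n) \prod_(i < k) F i (tnth t i).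
Proof.
rewrite bigA_distr_bigA.
rewrite (reindex (fun f : {ffun 'I_k -> 'I_n} => [tuple f i | i < k])) /=.
  by apply: eq_bigr => f _; apply: eq_bigr => i _; rewrite tnth_mktuple.
exists (fun t : k.-tuple 'I_n => [ffun i => tnth t i]) => [f|t] _.
  by apply/ffunP=> i; rewrite ffunE tnth_mktuple.
by apply: eq_from_tnth => i; rewrite tnth_mktuple ffunE.
Qed.

Lemma sum_perm_ffun (R : nmodType) (k : nat)
    (G : {ffun 'I_k -> 'I_k} -> R) :
  \sum_(f : {ffun 'I_k -> 'I_k} | injectiveb f) G f =
  \sum_(s : 'S_k) G (pval s).
Proof.
rewrite (reindex_onto (@pval _) (insubd (1%g : 'S_k))) /=; last first.
  by move=> f injf; rewrite -[LHS]/(val _) val_insubd injf.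
apply: eq_bigl => s; rewrite (valP s) andTb.
by apply/eqP/val_inj; rewrite val_insubd (valP s).
Qed.

(** Inclusion-exclusion: expanding the products gives a sum over maps [f], and the signed sum over
    the sets [I] containing the image of [f] vanishes unless [f] is surjective, that is, a
    permutation. *)
Lemma ryser (R : comNzRingType) (k : nat) (x : 'I_k -> 'I_k -> R) :
  \sum_(I : {set 'I_k}) (-1) ^+ #|~: I| * \prod_(i < k) \sum_(j in I) x j i =
  \sum_(s : 'S_k) \prod_(i < k) x (s i) i.
Proof.
have sgnE (f : {ffun 'I_k -> 'I_k}) :
    \sum_(I : {set 'I_k} | [forall i, f i \in I]) (-1) ^+ #|~: I|
      = (injectiveb f)%:R :> R.
  have -> : injectiveb f = [forall j, j \in codom f].
    apply/injectiveP/forallP => [injf j|sf].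
      exact: (inj_card_onto injf).
    have : codom f =i predT by move=> j; rewrite sf.
    move=> /eq_card cf; apply/injectiveP; rewrite /injectiveb/dinjectiveb.
    by apply/card_uniqP; rewrite size_map -cardE -[RHS]cf.
  (* Expanded over the set [I] of positions where the factor 1 is chosen, this product gives the
     signed sum: a term survives only if [I] contains the image of [f]. *)
  transitivity (\prod_(j < k) (1 + - (j \notin codom f)%:R) : R).
    rewrite bigA_distr [RHS](bigID (fun I : {set 'I_k} => [forall i, f i \in I])) /=.
    rewrite [X in _ = _ + X]big1 ?addr0.
      apply: eq_bigr => I /forallP fI.
      rewrite (bigID (fun j => j \in I)) /= [X in X * _]big1 ?mul1r; last first.
        by move=> i ->.
      rewrite -prodr_const; apply: eq_big => [i|i]; first by rewrite inE.
      rewrite inE => iI; rewrite (negPf iI).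
      suff -> : i \notin codom f by [].
      by apply: contra iI => /codomP [j ->].
    move=> I /forallPn [i fI]; rewrite (bigD1 (f i)) //= (negPf fI).
    by rewrite codom_f oppr0 mul0r.
  case: (boolP [forall _, _]) => [/forallP sf|/forallPn [j jf]].
    by rewrite big1 // => j _; rewrite sf subr0.
  by rewrite (bigD1 j) //= jf subrr mul0r.
under eq_bigr => I _ do rewrite bigA_distr_big mulr_sumr.
rewrite (exchange_big_dep predT) //=.
transitivity (\sum_(s : 'S_k) \prod_i x (pval s i) i); last first.
  by apply: eq_bigr => s _; apply: eq_bigr => i _; rewrite pvalE.
rewrite -(sum_perm_ffun (fun f => \prod_i x (f i) i)) [RHS]big_mkcond /=.
apply: eq_bigr => f _; rewrite -mulr_suml.
transitivity ((injectiveb f)%:R * \prod_i x (f i) i); last first.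
  by case: ifP; rewrite ?mul1r ?mul0r.
by rewrite -sgnE; congr (_ * _); apply: eq_bigl.
Qed.

(** * Powers on the unit circle and Gram matrices *)

Section NumClosed.
Variable C : numClosedFieldType.

(** If [a < b], a root [t] of order [b - a] of -1 lies on the unit circle and satisfies
    [t ^+ b = - t ^+ a], so equality of the powers would force [t = 0]. *)
Lemma unit_circle_expr_inj (a b : nat) :
  (forall t : C, `|t| = 1 -> t ^+ a = t ^+ b) -> a = b.
Proof.
wlog ab : a b / (a <= b)%N => [H|].
  by case/orP: (leq_total a b) => ab h; [apply: H|apply/esym/H => // t /h].
move=> h; apply/eqP; rewrite eqn_leq ab leqNgt; apply/negP => ltab.
have m0 : (0 < b - a)%N by rewrite subn_gt0.
pose t : C := (b - a).-root (-1).
have tm : t ^+ (b - a) = -1 by rewrite rootCK.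
have t1 : `|t| = 1.
  by apply/eqP; rewrite -(pexpr_eq1 m0) // -normrX tm normrN1.
have := h t t1; rewrite -[in t ^+ b](subnK ab) exprD tm mulN1r => /eqP.
rewrite -subr_eq0 opprK -mulr2n mulrn_eq0 /= expf_eq0 => /andP [_ /eqP t0].
by move: t1; rewrite t0 normr0 => /eqP; rewrite eq_sym oner_eq0.
Qed.

(** Since [X *m X ^t* = 0] forces [X = 0], row vectors killed by [M *m M ^t* *m M] are already
    killed by [M], so the ranks and then the row spaces agree. This replaces inverting the Gram
    matrix [M *m M ^t*], which may be singular. *)
Lemma submx_gram (m p : nat) (M : 'M[C]_(m, p)) : (M <= M *m M ^t* *m M)%MS.
Proof.
have herm0 (q r : nat) (X : 'M[C]_(q, r)) : X *m X ^t* = 0 -> X = 0.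
  move=> XX; apply/matrixP => i j; rewrite mxE.
  have /eqP : (X *m X ^t*) i i = 0 by rewrite XX mxE.
  rewrite mxE psumr_eq0 => [/allP /(_ j)|l _]; last first.
    by rewrite !mxE -normCK exprn_ge0.
  rewrite mem_index_enum !mxE -normCK expf_eq0 /= normr_eq0.
  by move=> /(_ isT) /eqP.
suff rk : \rank (M *m M ^t* *m M) = \rank M.
  have sub : (M *m M ^t* *m M <= M)%MS by apply: submxMl.
  by move: (mxrank_leqif_sup sub) => [_]; rewrite rk eqxx => <-.
apply/eqP; rewrite eqn_leq mxrankM_maxr /=.
have mono (X Y : 'M[C]_(m, p)) : (forall w : 'rV_m, w *m X = 0 -> w *m Y = 0) ->
    (\rank Y <= \rank X)%N.
  move=> h; have : (kermx X <= kermx Y)%MS.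
    apply/sub_kermxP/row_matrixP => i; rewrite row_mul row0; apply: h.
    by rewrite -row_mul mulmx_ker row0.
  move/mxrankS; rewrite !mxrank_ker => le.
  by have := rank_leq_row Y; have := rank_leq_row X; lia.
apply: mono => w; rewrite !mulmxA => w0.
apply: (herm0); rewrite trmx_mul map_mxM !mulmxA.
suff -> : w *m M *m M ^t* = 0 by rewrite mul0mx.
apply: herm0; rewrite !(trmx_mul, map_mxM) trmxCK !mulmxA.
by rewrite w0 !mul0mx.
Qed.
End NumClosed.

Section SchurWeyl.
Variables (C : numClosedFieldType) (n k : nat).
Local Notation word := (k.-tuple 'I_n).
Implicit Types (c d : word -> word -> C) (a b : 'M[C]_n) (s : 'S_k).

(** Matrix entries of the k-th tensor power of [a] in the basis of words. Operators on that tensor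
    power are kept as functions of two words and multiplied by [kmul]. *)
Definition tensor_pow a : word -> word -> C :=
  fun al be => \prod_(i < k) a (tnth al i) (tnth be i).

(** The product [s * t] applies [s] first, so permuting positions in this way is a left action. *)
Definition word_act s (al : word) : word := [tuple tnth al (s i) | i < k].

Definition kmul c d : word -> word -> C :=
  fun al be => \sum_ga c al ga * d ga be.

Definition kcomm c d := kmul c d =2 kmul d c.

Lemma word_actM s t al : word_act s (word_act t al) = word_act (s * t)%g al.
Proof. by apply: eq_from_tnth => i; rewrite !tnth_mktuple permM. Qed.

Lemma word_act1 al : word_act 1%g al = al.
Proof. by apply: eq_from_tnth => i; rewrite tnth_mktuple perm1. Qed.

Lemma word_act_inj s : injective (word_act s).
Proof.
apply: (can_inj (g := word_act s^-1%g)) => al.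
by rewrite word_actM mulVg word_act1.
Qed.

Lemma tensor_powM a b : tensor_pow (a *m b) =2 kmul (tensor_pow a) (tensor_pow b).
Proof.
move=> al be; rewrite /tensor_pow; under eq_bigr => i _ do rewrite mxE.
rewrite (prod_sum_tuple (fun i j => a (tnth al i) j * b j (tnth be i))).
by apply: eq_bigr => ga _; rewrite -big_split.
Qed.

Lemma kcomm_eq c d e : d =2 e -> kcomm c d -> kcomm c e.
Proof.
move=> de cd al be; transitivity (kmul c d al be).
  by apply: eq_bigr => ga _; rewrite de.
by rewrite cd; apply: eq_bigr => ga _; rewrite de.
Qed.

Lemma kmulA c d e : kmul c (kmul d e) =2 kmul (kmul c d) e.
Proof.
move=> al be; rewrite /kmul; under eq_bigr => ga _ do rewrite mulr_sumr.
rewrite exchange_big /=; apply: eq_bigr => de _.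
by rewrite mulr_suml; apply: eq_bigr => ga _; rewrite mulrA.
Qed.

Lemma kcommM c d e : kcomm c d -> kcomm c e -> kcomm c (kmul d e).
Proof.
move=> cd ce al be; rewrite kmulA -[RHS]kmulA.
transitivity (kmul (kmul d c) e al be).
  by apply: eq_bigr => ga _; rewrite cd.
by rewrite -kmulA; apply: eq_bigr => ga _; rewrite ce.
Qed.

Lemma tensor_pow_diag (v : 'rV[C]_n) al be :
  tensor_pow (diag_mx v) al be = (al == be)%:R * \prod_(x <- be) v 0 x.
Proof.
rewrite /tensor_pow big_tuple; case: eqP => [->|ne].
  by rewrite mul1r; apply: eq_bigr => i _; rewrite mxE eqxx.
rewrite mul0r; apply/eqP/negPn/negP => /prodf_neq0 nz.
case: ne; apply: eq_from_tnth => i; apply/eqP.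
by have := nz i isT; rewrite mxE; apply: contraR => /negPf ->; rewrite mulr0n.
Qed.

Lemma kcomm_diag c (v : 'rV[C]_n) :
  kcomm c (tensor_pow (diag_mx v)) <->
  forall al be, c al be * \prod_(x <- be) v 0 x
              = \prod_(x <- al) v 0 x * c al be.
Proof.
have E1 al be : kmul c (tensor_pow (diag_mx v)) al be =
    c al be * \prod_(x <- be) v 0 x.
  rewrite /kmul (bigD1 be) //= [X in _ + X]big1 => [|ga].
    by rewrite addr0 tensor_pow_diag eqxx mul1r.
  by move=> /negPf ne; rewrite tensor_pow_diag ne mul0r mulr0.
have E2 al be : kmul (tensor_pow (diag_mx v)) c al be =
    \prod_(x <- al) v 0 x * c al be.
  rewrite /kmul (bigD1 al) //= [X in _ + X]big1 => [|ga].
    by rewrite addr0 tensor_pow_diag eqxx mul1r.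
  by rewrite eq_sym => /negPf ne; rewrite tensor_pow_diag ne !mul0r.
by split=> h al be; have := h al be; rewrite E1 E2.
Qed.

Definition fixed_by_unitaries c :=
  forall a, a \is unitarymx -> kcomm c (tensor_pow a).

(** Testing against the diagonal unitary with entry [t] at [x] and 1 elsewhere shows that [c al be]
    vanishes unless [al] and [be] contain each letter equally often. Such words give the same
    product of entries for every diagonal matrix. *)
Lemma kcomm_all_diag c : fixed_by_unitaries c ->
  forall v : 'rV[C]_n, kcomm c (tensor_pow (diag_mx v)).
Proof.
move=> h v; apply/kcomm_diag => al be.
have [->|c0] := eqVneq (c al be) 0; first by rewrite mul0r mulr0.
suff eqp : perm_eq be al by rewrite (perm_big _ eqp) mulrC.
apply/allP => x _ /=; apply/eqP.
apply: (@unit_circle_expr_inj C) => t t1.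
pose w : 'rV[C]_n := \row_j (if j == x then t else 1).
have pw (ga : word) : \prod_(y <- ga) w 0 y = t ^+ count_mem x ga.
  elim: (val ga) => [|y r IH] /=; first by rewrite big_nil.
  by rewrite big_cons IH mxE; case: eqP => _; rewrite ?mul1r // -exprS.
have : diag_mx w \is unitarymx.
  apply/unitarymxP/matrixP => i j.
  rewrite tr_diag_mx map_diag_mx mulmx_diag !mxE; congr (_ *+ _).
  by case: eqP; rewrite -normCK ?t1 ?normr1 expr1n.
move=> /h /kcomm_diag /(_ al be); rewrite !pw mulrC => /(mulIf c0).
by move->.
Qed.

(** The spectral theorem factors [a] into unitary, diagonal and unitary matrices, and tensor powers
    are multiplicative. *)
Lemma kcomm_hermitian c a : fixed_by_unitaries c ->
  a ^t* = a -> kcomm c (tensor_pow a).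
Proof.
move=> h aH.
have /orthomx_spectralP -> : a \is normalmx by apply/normalmxP; rewrite aH.
set P := spectralmx a; have PU : P \is unitarymx by apply: spectral_unitarymx.
apply: (kcomm_eq (fun al be => esym (tensor_powM _ _ al be))).
apply: kcommM; last exact: h.
apply: (kcomm_eq (fun al be => esym (tensor_powM _ _ al be))).
apply: kcommM; last exact: kcomm_all_diag.
by rewrite invmx_unitary //; apply: h; rewrite trmxC_unitary.
Qed.

(* Write [a = h1 + 'i h2] with [h1], [h2] Hermitian; the commutator of [c] with
   the tensor power of [h1 + s h2] is a polynomial in [s] vanishing at all
   natural numbers, hence at ['i]. *)
Lemma kcomm_all c a : fixed_by_unitaries c -> kcomm c (tensor_pow a).
Proof.
move=> h al be.
pose h1 := 2%:R^-1 *: (a + a ^t*); pose h2 := (- 'i / 2%:R) *: (a - a ^t*).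
have real_pt (s : C) : s \is Num.real ->
    kcomm c (tensor_pow (h1 + s *: h2)).
  move=> sR; apply: kcomm_hermitian => //.
  apply/matrixP => i j; rewrite !mxE.
  rewrite !(rmorphD, rmorphM, rmorphN, fmorphV, rmorph1) /= conjCi !conjCK.
  by rewrite (CrealP sR); ring.
pose q i j : {poly C} := (h1 i j)%:P + (h2 i j) *: 'X.
pose p := \sum_ga (c al ga)%:P * \prod_(i < k) q (tnth ga i) (tnth be i) -
          \sum_ga (\prod_(i < k) q (tnth al i) (tnth ga i)) * (c ga be)%:P.
have qE (s : C) de ga : (\prod_(i < k) q (tnth de i) (tnth ga i)).[s] =
    tensor_pow (h1 + s *: h2) de ga.
  rewrite horner_prod; apply: eq_bigr => i _.
  by rewrite /q !hornerE !mxE; ring.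
have pE (s : C) : p.[s] = kmul c (tensor_pow (h1 + s *: h2)) al be -
                    kmul (tensor_pow (h1 + s *: h2)) c al be.
  rewrite /p hornerD hornerN !horner_sum; congr (_ - _);
    by apply: eq_bigr => ga _; rewrite hornerM hornerC qE.
have p0 : p = 0.
  apply/eqP/negPn/negP => pn0.
  have := max_poly_roots pn0 (rs := [seq i%:R | i <- iota 0 (size p)]).
  rewrite size_map size_iota ltnn => H; suff : false by [].
  apply: H; last first.
    by rewrite map_inj_uniq ?iota_uniq // => i j /eqP; rewrite eqr_nat => /eqP.
  apply/allP => _ /mapP [i _ ->]; by rewrite rootE pE (real_pt _ (realn _ i)) subrr.
have aE : a = h1 + 'i *: h2.
  apply/matrixP => i j; rewrite !mxE.
  have -> (x y : C) : 2^-1 * (x + y) + 'i * (- 'i / 2 * (x - y)) =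
    2^-1 * (x + y) - ('i ^+ 2) / 2 * (x - y) by ring.
  by rewrite sqrCi; field.
by apply/eqP; rewrite -subr_eq0 {1 2}aE -pE p0 horner0.
Qed.

(* Polarization of [kcomm_all]: by Ryser's formula, the signed sum over [I] of
   the tensor powers of the sums over [j] in [I] of the matrix units at
   [(b_j, g_j)] is the operator with matrix entries
   [\sum_s (al == word_act s b) * (be == word_act s g)]. *)
Lemma kcomm_word_act c (b g : word) : fixed_by_unitaries c ->
  forall al be,
    \sum_(s : 'S_k) c al (word_act s b) * (be == word_act s g)%:R =
    \sum_(s : 'S_k) (al == word_act s b)%:R * c (word_act s g) be.
Proof.
move=> h al be.
pose aI (I : {set 'I_k}) : 'M[C]_n :=
  \sum_(j in I) delta_mx (tnth b j) (tnth g j).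
have polar ga de : \sum_(I : {set 'I_k}) (-1) ^+ #|~: I| * tensor_pow (aI I) ga de
    = \sum_(s : 'S_k) (ga == word_act s b)%:R * (de == word_act s g)%:R.
  pose x (j i : 'I_k) : C :=
    (tnth ga i == tnth b j)%:R * (tnth de i == tnth g j)%:R.
  transitivity (\sum_(I : {set 'I_k})
      (-1) ^+ #|~: I| * \prod_(i < k) \sum_(j in I) x j i).
    apply: eq_bigr => I _; congr (_ * _); apply: eq_bigr => i _.
    rewrite /aI summxE; apply: eq_bigr => j _.
    by rewrite mxE /x -natrM mulnb.
  rewrite ryser; apply: eq_bigr => s _; rewrite /x big_split /=.
  have eqE (t v : word) :
      \prod_(i < k) (tnth t i == tnth v (s i))%:R = (t == word_act s v)%:R :> C.
    case: eqP => [->|ne].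
      by rewrite big1 // => i _; rewrite tnth_mktuple eqxx.
    apply/eqP/negPn/negP => /prodf_neq0 nz; case: ne.
    apply: eq_from_tnth => i; rewrite tnth_mktuple; apply/eqP.
    by have := nz i isT; apply: contraR => /negPf ->.
  by rewrite !eqE.
have delta (v : word) (F : word -> C) : \sum_t (t == v)%:R * F t = F v.
  rewrite (bigD1 v) //= eqxx mul1r big1 ?addr0 // => t /negPf ->.
  by rewrite mul0r.
transitivity (\sum_ga c al ga *
    \sum_(I : {set 'I_k}) (-1) ^+ #|~: I| * tensor_pow (aI I) ga be).
  under [RHS]eq_bigr => ga _ do rewrite polar mulr_sumr.
  rewrite exchange_big /=; apply: eq_bigr => s _.
  rewrite -[LHS](delta _ (fun t => c al t * (be == word_act s g)%:R)).
  by apply: eq_bigr => ga _; rewrite mulrCA.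
transitivity (\sum_ga (\sum_(I : {set 'I_k})
    (-1) ^+ #|~: I| * tensor_pow (aI I) al ga) * c ga be); last first.
  under eq_bigr => ga _ do rewrite polar mulr_suml.
  rewrite exchange_big /=; apply: eq_bigr => s _.
  rewrite -[RHS](delta _ (fun t => (al == word_act s b)%:R * c t be)).
  by apply: eq_bigr => ga _; rewrite -mulrA mulrCA.
under eq_bigr => ga _ do rewrite mulr_sumr.
under [RHS]eq_bigr => ga _ do rewrite mulr_suml.
rewrite exchange_big [RHS]exchange_big; apply: eq_bigr => I _ /=.
under eq_bigr => ga _ do rewrite mulrCA.
under [RHS]eq_bigr => ga _ do rewrite -mulrA.
by rewrite -!mulr_sumr; congr (_ * _); apply: kcomm_all.
Qed.

(* Summing [kcomm_word_act] over [be = g] shows that [c * kappa] lies in the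
   span of the permutations, where [kappa] is the sum of [tr s * s] over all
   permutations [s]; [submx_gram] provides an inverse of [kappa] in that span. *)
Theorem schur_weyl c : fixed_by_unitaries c ->
  exists w : 'S_k -> C, forall al be,
    c al be = \sum_(s : 'S_k) w s * (al == word_act s be)%:R.
Proof.
move=> h.
(* [fix_ s] is the trace of the operator of [s], and [t s] is the trace of [c] composed with the
   operator of [s^-1]. *)
pose fix_ s : C := \sum_(g : word) (g == word_act s g)%:R.
pose t s : C := \sum_(g : word) c (word_act s g) g.
have cfix al be : \sum_s fix_ s * c al (word_act s be) =
    \sum_s t s * (al == word_act s be)%:R.
  under eq_bigr => s _ do rewrite mulr_suml.
  under [RHS]eq_bigr => s _ do rewrite mulr_suml.
  rewrite exchange_big [RHS]exchange_big /=; apply: eq_bigr => g _.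
  under eq_bigr => s _ do rewrite mulrC.
  under [RHS]eq_bigr => s _ do rewrite mulrC.
  exact: kcomm_word_act.
(* The rows of [M] are the permutation operators written out as vectors. The Gram entry at [r] and
   [s * r] is [fix_ s], so the row of the identity in [submx_gram] writes the identity as [kappa]
   times the combination of permutations with coefficients [x]. *)
pose M : 'M[C]_(#|{: 'S_k}|, #|{: word * word}|) := \matrix_(i, j)
  ((enum_val j).1 == word_act (enum_val i) (enum_val j).2)%:R.
have [x xE] : exists x : 'S_k -> C, forall al be,
    (al == be)%:R = \sum_r x r * \sum_s fix_ s * (al == word_act (s * r)%g be)%:R.
  have /submxP [X XE] := submx_gram M.
  exists (fun r => X (enum_rank 1%g) (enum_rank r)) => al be.
  have := congr1 (fun Y : 'M[C]_(_, _) => Y (enum_rank 1%g) (enum_rank (al, be))) XE.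
  rewrite [in LHS]mxE !enum_rankK /= word_act1 => ->.
  rewrite mxE (reindex enum_rank) /=; last first.
    by exists enum_val => ? _; rewrite ?enum_rankK ?enum_valK.
  apply: eq_bigr => r _; congr (_ * _).
  rewrite mxE (reindex enum_rank) /=; last first.
    by exists enum_val => ? _; rewrite ?enum_rankK ?enum_valK.
  rewrite (reindex (fun s => (s * r)%g)) /=; last first.
    by exists (fun s => (s * r^-1)%g) => s _; rewrite ?mulgK ?mulgKV.
  apply: eq_bigr => s _; rewrite [M _ _]mxE !enum_rankK /=; congr (_ * _).
  rewrite mxE (reindex enum_rank) /=; last first.
    by exists enum_val => ? _; rewrite ?enum_rankK ?enum_valK.
  transitivity (\sum_(p : word * word) (p.1 == word_act r p.2)%:R *
      (p.1 == word_act (s * r)%g p.2)%:R : C).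
    by apply: eq_bigr => p _; rewrite !mxE !enum_rankK conjC_nat.
  rewrite -(pair_big xpredT xpredT (fun u v => (u == word_act r v)%:R *
      (u == word_act (s * r)%g v)%:R : C)) exchange_big /=.
  rewrite /fix_ [RHS](reindex (word_act r)) /=; last first.
    exists (word_act r^-1%g) => u _; by rewrite word_actM ?mulVg ?mulgV word_act1.
  apply: eq_bigr => v _; rewrite (bigD1 (word_act r v)) //= eqxx mul1r.
  rewrite word_actM big1 ?addr0 // => u /negPf ->; exact: mul0r.
(* The convolution of [t] and [x] comes from multiplying [cfix] on the right by the inverse of
   [kappa]. *)
exists (fun s => \sum_r x r * t (s * r^-1)%g) => al be.
transitivity (\sum_ga c al ga * (ga == be)%:R).
  rewrite (bigD1 be) //= eqxx mulr1 big1 ?addr0 // => ga /negPf ->.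
  exact: mulr0.
under eq_bigr => ga _ do rewrite xE mulr_sumr.
rewrite exchange_big; under [RHS]eq_bigr => s _ do rewrite mulr_suml.
rewrite [RHS]exchange_big /=; apply: eq_bigr => r _.
under eq_bigr => ga _ do rewrite mulrCA.
under [RHS]eq_bigr => s _ do rewrite -mulrA.
rewrite -!mulr_sumr; congr (_ * _).
under eq_bigr => ga _ do rewrite mulr_sumr.
rewrite exchange_big /=.
rewrite [RHS](reindex (fun s => (s * r)%g)) /=; last first.
  by exists (fun s => (s * r^-1)%g) => s _; rewrite ?mulgK ?mulgKV.
under [RHS]eq_bigr => s _ do rewrite mulgK -word_actM.
rewrite -cfix; apply: eq_bigr => s _; rewrite -word_actM.
rewrite (bigD1 (word_act s (word_act r be))) //= eqxx mulr1 mulrC big1 ?addr0 //.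
by move=> ga /negPf ->; rewrite !mulr0.
Qed.

End SchurWeyl.

(** * Elementary C*-algebra theory *)

Lemma dist_complete (K : numFieldType) (V : completeNormedModType K) (x : nat -> V) :
  (forall e : K, 0 < e -> exists N, forall m n, (N <= m)%N -> (N <= n)%N ->
     `|x m - x n| < e) ->
  exists l, forall e : K, 0 < e -> exists N, forall n, (N <= n)%N ->
     `|l - x n| < e.
Proof.
move=> cx.
have : cauchy (x @ \oo).
  apply/cauchy_ballP => e e0; have [N hN] := cx e e0.
  exists (x @` [set m | (N <= m)%N], x @` [set m | (N <= m)%N]) => //=.
    by split; exists N => // m /= Nm; exists m.
  move=> [_ _] /= [[m mN <-] [p pN <-]].
  by rewrite -ball_normE /=; apply: hN.
move=> /cauchy_cvgP /cvg_ex [l xl]; exists l => e e0.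
have /cvgrPdist_lt /(_ e e0) [N _ hN] := xl.
by exists N.
Qed.

Section ComplexNormed.
Variables (R : realType).
Local Notation C := R[i].

Lemma closure_distP (V : normedModType C) (E : set V) (x : V) :
  closure E x <-> forall e : C, 0 < e -> exists2 y, E y & `|x - y| < e.
Proof.
split=> [clE e e0|h B /nbhs_ballP [e /= e0 eB]].
  have [y [Ey xy]] := clE _ (nbhsx_ballx x e e0).
  by exists y => //; move: xy; rewrite -ball_normE.
have [y Ey xy] := h e e0; exists y; split=> //; apply: eB.
by rewrite -ball_normE.
Qed.

(** The order of [R[i]] forces [q] and [e] to be real, so this is the limit of powers in [R]. *)
Lemma exprC_small (q e : C) : 0 <= q < 1 -> 0 < e -> exists n, q ^+ n < e.
Proof.
case: q => q1 q2; case: e => e1 e2; rewrite !lecE !ltcE /=.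
move=> /andP [/andP [/eqP -> q0] /andP [_ q1lt]] /andP [/eqP -> e0].
have : q1 ^+ n @[n --> \oo] --> 0.
  by apply: cvg_expr; rewrite ger0_norm.
move=> /cvgrPdist_lt /(_ e1 e0) [N _ /(_ N (leqnn N))] /=.
rewrite sub0r normrN ger0_norm ?exprn_ge0 // => qe; exists N.
have -> : (q1 +i* 0)%C = real_complex R q1 by [].
by rewrite -rmorphXn ltcE /= eqxx.
Qed.

Lemma norm_small0 (V : normedModType C) (x : V) :
  (forall e : C, 0 < e -> `|x| <= e) -> x = 0.
Proof.
move=> h; apply/normr0_eq0/le_anti; rewrite normr_ge0 andbT.
by apply/ler_addgt0Pr => e /h; rewrite add0r.
Qed.
End ComplexNormed.

Section CStar.
Variables (R : realType) (A : cstarAlgType R).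
Local Notation C := R[i].
Implicit Types (x y a h k : A).

Lemma star1 : star (1 : A) = 1.
Proof. by rewrite -[LHS]mulr1 -[X in _ * X](starK 1) -starM mulr1 starK. Qed.

Lemma star0 : star (0 : A) = 0.
Proof. by apply: (addrI (star 0)); rewrite -starD !addr0. Qed.

Lemma starN x : star (- x) = - star x.
Proof. by apply: (addrI (star x)); rewrite -starD !subrr star0. Qed.

Lemma starB x y : star (x - y) = star x - star y.
Proof. by rewrite starD starN. Qed.

Lemma star_sum (I : Type) (r : seq I) (P : pred I) (F : I -> A) :
  star (\sum_(i <- r | P i) F i) = \sum_(i <- r | P i) star (F i).
Proof. exact: (big_morph _ (@starD R A) star0). Qed.

Lemma norm_star x : `|star x| = `|x|.
Proof.
have le y : `|y| <= `|star y|.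
  have [->|y0] := eqVneq y 0; first by rewrite normr0.
  rewrite -(ler_pM2r (_ : 0 < `|y|)) ?normr_gt0 //.
  by rewrite -expr2 -norm_starM normrM_le.
by apply/le_anti; rewrite le andbT -{2}[x]starK le.
Qed.

Lemma norm_one : `|1 : A| = 1.
Proof.
have n0 : `|1 : A| != 0 by rewrite normr_eq0 oner_neq0.
by apply: (mulIf n0); rewrite mul1r -expr2 -norm_starM star1 mulr1.
Qed.

Lemma norm_isometry x : star x * x = 1 -> `|x| = 1.
Proof.
move=> xx; have := norm_starM x; rewrite xx norm_one => /esym/eqP.
by rewrite pexpr_eq1 // => /eqP.
Qed.

Lemma norm_small2 (V : normedModType C) (x : V) :
  (forall e : C, 0 < e -> `|x| <= e + e) -> x = 0.
Proof.
move=> h; apply: norm_small0 => e e0; rewrite [e]splitr; apply: h.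
by rewrite divr_gt0.
Qed.

(* [b = 1 - l] where [l] is the fixed point of [c |-> (w + c^2) / 2]. *)
Lemma sqrt_one_sub (w : A) : star w = w -> `|w| < 1 ->
  exists b, [/\ star b = b, b * b = 1 - w &
    forall x, x * w = w * x -> x * b = b * x].
Proof.
move=> wS; set q := `|w| => q1.
have q0 : 0 <= q by apply: normr_ge0.
pose step (c : A) := (2^-1 : C) *: (w + c * c).
have h2 : (0 : C) <= 2^-1 by rewrite invr_ge0.
(* On the ball of radius [q < 1] the map [step] is a [q]-contraction; the difference of squares is
   split without assuming that [x] and [y] commute. *)
have step_dist x y : `|x| <= q -> `|y| <= q -> `|step x - step y| <= q * `|x - y|.
  move=> xq yq; rewrite /step -scalerBr opprD addrACA subrr add0r.
  have -> : x * x - y * y = x * (x - y) + (x - y) * y.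
    by rewrite mulrBr mulrBl addrA subrK.
  rewrite normrZ ger0_norm // -(ler_pM2l (_ : 0 < 2)) // mulrA mulfV //.
  rewrite mul1r (le_trans (ler_normD _ _)) // mulr_natl mulr2n lerD //.
    by rewrite (le_trans (normrM_le _ _)) // ler_wpM2r.
  by rewrite (le_trans (normrM_le _ _)) // mulrC ler_wpM2r.
pose c m := iter m step 0.
have cq m : `|c m| <= q.
  elim: m => [|m IH]; first by rewrite normr0.
  rewrite /c iterS -/(c m) normrZ ger0_norm // -(ler_pM2l (_ : 0 < 2)) //.
  rewrite mulrA mulfV // mul1r (le_trans (ler_normD _ _)) //.
  rewrite mulr_natl mulr2n lerD // (le_trans (normrM_le _ _)) //.
  by rewrite (le_trans (ler_pM _ _ IH IH)) // ler_piMr // ltW.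
have cS m : star (c m) = c m.
  elim: m => [|m IH]; first by rewrite star0.
  rewrite /c iterS -/(c m) starZ starD !starM wS IH fmorphV /=.
  by rewrite conjC_nat.
have cx x m : x * w = w * x -> x * c m = c m * x.
  move=> xw; elim: m => [|m IH]; first by rewrite mulr0 mul0r.
  rewrite /c iterS -/(c m) -scalerAr -scalerAl mulrDr mulrDl xw mulrA IH.
  by rewrite -!mulrA IH.
have cdist m n : `|c (m + n)%N - c n| <= q ^+ n.
  elim: n => [|n IH].
    by rewrite subr0 expr0 (le_trans (cq _)) // ltW.
  rewrite addnS /c !iterS -/(c _) -/(c n).
  by rewrite (le_trans (step_dist _ _ _ _)) // exprS ler_wpM2l.
have [l lP] : exists l, forall e : C, 0 < e -> exists N, forall n, (N <= n)%N ->
     `|l - c n| < e.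
  apply: dist_complete => e e0.
  have e20 : 0 < e / 2 by rewrite divr_gt0.
  have [|N qN] := @exprC_small R q (e / 2) _ e20; first by rewrite q0.
  exists N => m n Nm Nn; rewrite -(subnK Nm) -(subnK Nn).
  rewrite [e]splitr (le_lt_trans (ler_distD (c N) _ _)) // ltrD //.
    by rewrite (le_lt_trans (cdist _ _)).
  by rewrite distrC (le_lt_trans (cdist _ _)).
have lq : `|l| <= q.
  apply/ler_addgt0Pr => e /lP [N /(_ N (leqnn N)) lN].
  rewrite -[l](subrK (c N)) (le_trans (ler_normD _ _)) // addrC lerD //.
  exact: ltW.
have lS : star l = l.
  apply/eqP; rewrite -subr_eq0; apply/eqP/norm_small2 => e.
  move=> /lP [N /(_ N (leqnn N)) /ltW lN].
  rewrite (le_trans (ler_distD (c N) _ _)) // lerD //; last by rewrite distrC.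
  by rewrite -{1}cS -starB norm_star.
have lx x : x * w = w * x -> x * l = l * x.
  move=> xw; apply/eqP; rewrite -subr_eq0; apply/eqP/norm_small2 => e e0.
  have x1 : 0 < 1 + `|x| by rewrite ltr_wpDr.
  have [|N /(_ N (leqnn N)) /ltW lN] := lP (e / (1 + `|x|)).
    by rewrite divr_gt0.
  have -> : x * l - l * x = x * (l - c N) - (l - c N) * x.
    by rewrite mulrBr mulrBl cx // opprB addrA subrK.
  have le : `|x| * `|l - c N| <= e.
    rewrite -(divfK (lt0r_neq0 x1) e) mulrC ler_pM // lerDr.
    exact: ler01.
  rewrite (le_trans (ler_normB _ _)) // lerD //.
    by rewrite (le_trans (normrM_le _ _)).
  by rewrite (le_trans (normrM_le _ _)) // mulrC.
have lE : l = step l.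
  apply/eqP; rewrite -subr_eq0; apply/eqP/norm_small2 => e.
  move=> /lP [N lN].
  rewrite (le_trans (ler_distD (c N.+1) _ _)) // lerD //.
    by rewrite ltW // lN.
  rewrite /c iterS -/(c N) (le_trans (step_dist _ _ _ _)) // distrC.
  by rewrite (le_trans _ (ltW (lN N (leqnn N)))) // ler_piMl // ltW.
(* This is the equation [(1 - l)^2 = 1 - w]. *)
have l2 : l + l = w + l * l.
  rewrite {1 2}lE -scalerDl; have -> : (2^-1 + 2^-1 : C) = 1 by field.
  by rewrite scale1r.
exists (1 - l); split; first by rewrite starB star1 lS.
  have -> : w = l + (l - l * l) by rewrite addrA l2 addrK.
  by rewrite opprD addrA mulrBr mulr1 mulrBl mul1r.
by move=> x xw; rewrite mulrBr mulrBl mulr1 mul1r lx.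
Qed.

Section NormalPair.
Variables a b : A.
Hypotheses (aS : star a = a) (bS : star b = b) (ab : a * b = b * a).

Lemma star_cartesian : star (a + ('i : C) *: b) = a - ('i : C) *: b.
Proof. by rewrite starD starZ aS bS conjCi scaleNr. Qed.

Let ii : ('i * 'i : C) = -1. Proof. by rewrite -expr2 sqrCi. Qed.

Lemma cartesian_starM :
  (a - ('i : C) *: b) * (a + ('i : C) *: b) = a * a + b * b.
Proof.
rewrite mulrDr !mulrBl -!scalerAl -!scalerAr scalerA ii scaleN1r.
by rewrite ab opprK addrA subrK.
Qed.

Lemma real_part_cartesian :
  a = (2^-1 : C) *: ((a + ('i : C) *: b) + star (a + ('i : C) *: b)).
Proof.
rewrite star_cartesian addrACA subrr addr0 -mulr2n -[a *+ 2]scaler_nat.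
by rewrite scalerA mulVf // scale1r.
Qed.

(** With [z = a + 'i b], [a] is the mean of [z] and its adjoint, so its norm is at most that of [z];
    and [star z * z = a^2 + b^2] because [a] and [b] commute. *)
Lemma norm_real_part : `|a| ^+ 2 <= `|a * a + b * b|.
Proof.
set z := a + ('i : C) *: b.
have -> : `|a * a + b * b| = `|z| ^+ 2.
  by rewrite -norm_starM star_cartesian cartesian_starM.
rewrite lerXn2r ?nnegrE // real_part_cartesian -/z normrZ ger0_norm ?invr_ge0 //.
rewrite -(ler_pM2l (_ : 0 < 2)) // mulrA mulfV // mul1r mulr_natl mulr2n.
by rewrite (le_trans (ler_normD _ _)) // norm_star.
Qed.
End NormalPair.

Lemma norm_selfadj_sqr a : star a = a -> `|a * a| = `|a| ^+ 2.
Proof. by move=> aS; rewrite -norm_starM aS. Qed.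

(* With [T = 1 + k^2] and [c^2 = 1 + 9 T / 16], the element [k c] satisfies
   [1 + (k c)^2 = (7 T + 9 T^2) / 16] and
   [(k c)^2 = (5 k / 4)^2 + (3 k^2 / 4)^2], so passing from [k] to [k c]
   preserves the hypothesis while [`|k|^2] grows by the factor 25/16. *)
Lemma norm_one_addM_le1 k : star k = k -> `|1 + k * k| <= 1 -> k = 0.
Proof.
have bound N : forall k, star k = k -> `|1 + k * k| <= 1 ->
    `|k| ^+ 2 <= 2 * (16 / 25) ^+ N.
  elim: N => [|N IH] {}k kS k1.
    rewrite expr0 mulr1 -norm_selfadj_sqr // -[k * k](addKr 1).
    by rewrite (le_trans (ler_normD _ _)) // normrN norm_one lerD.
  pose T := 1 + k * k; pose w := - (9 / 16 : C) *: T.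
  have TS : star T = T by rewrite starD star1 starM kS.
  have s0 : (0 : C) <= 9 / 16 by rewrite divr_ge0.
  have wS : star w = w by rewrite starZ TS conj_Creal // rpredN ger0_real.
  have w1 : `|w| < 1.
    rewrite normrZ normrN ger0_norm // (@le_lt_trans _ _ (9 / 16 * 1)) //.
      by rewrite ler_wpM2l.
    by rewrite mulr1 ltr_pdivrMr // mul1r ltr_nat.
  have [c [cS cc cx]] := sqrt_one_sub wS w1.
  have kc : k * c = c * k.
    apply: cx; rewrite /w -scalerAr -scalerAl; congr (_ *: _).
    by rewrite /T mulrDr mulrDl mulr1 mul1r mulrA.
  have kcS : star (k * c) = k * c by rewrite starM kS cS kc.
  have kckc : k * c * (k * c) =
      k * k + (9 / 16 : C) *: (k * k + k * k * (k * k)).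
    rewrite -mulrA [X in k * X]mulrA -kc -mulrA cc mulrA /w scaleNr opprK.
    move: (9 / 16 : C) => t.
    by rewrite mulrDr mulr1 -scalerAr /T mulrDr mulr1.
  have : `|k * c| ^+ 2 <= 2 * (16 / 25) ^+ N.
    apply: IH => //.
    have -> : 1 + k * c * (k * c) = (7 / 16 : C) *: T + (9 / 16 : C) *: (T * T).
      have -> : (7 / 16 : C) = 1 - 9 / 16 by field.
      rewrite kckc; move: (9 / 16 : C) => t.
      have TT : T * T - T = k * k + k * k * (k * k).
        by rewrite -{3}[T]mul1r -mulrBl /T [X in X * _]addrC addKr mulrDr mulr1.
      by rewrite scalerBl scale1r -addrA [- _ + _]addrC -scalerBr TT addrA.
    rewrite (le_trans (ler_normD _ _)) // !normrZ !ger0_norm ?divr_ge0 //.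
    rewrite [X in _ <= X](_ : _ = 7 / 16 * 1 + 9 / 16 * 1); last by field.
    rewrite lerD // ler_wpM2l ?divr_ge0 // (le_trans (normrM_le _ _)) //.
    by rewrite -[X in _ <= X]mulr1 ler_pM.
  have kckc2 : k * c * (k * c) = (5 / 4 : C) *: k * ((5 / 4 : C) *: k) +
      (3 / 4 : C) *: (k * k) * ((3 / 4 : C) *: (k * k)).
    rewrite -!scalerAl -!scalerAr !scalerA.
    have -> : (5 / 4 * (5 / 4) : C) = 1 + 9 / 16 by field.
    have -> : (3 / 4 * (3 / 4) : C) = 9 / 16 by field.
    by rewrite kckc; move: (9 / 16 : C) => t; rewrite scalerDl scale1r scalerDr addrA.
  have ck : star ((5 / 4 : C) *: k) = (5 / 4 : C) *: k.
    by rewrite starZ kS conj_Creal // ger0_real // divr_ge0.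
  have ckk : star ((3 / 4 : C) *: (k * k)) = (3 / 4 : C) *: (k * k).
    by rewrite starZ starM kS conj_Creal // ger0_real // divr_ge0.
  have comm : (5 / 4 : C) *: k * ((3 / 4 : C) *: (k * k)) =
              (3 / 4 : C) *: (k * k) * ((5 / 4 : C) *: k).
    rewrite -!scalerAl -!scalerAr !scalerA; congr (_ *: _).
      exact: mulrC.
    exact: mulrA.
  (* Dropping the second square by [norm_real_part] bounds [(5/4)^2] times the squared norm of [k],
     and [(5/4)^2] absorbs one factor [16/25]. *)
  rewrite -norm_selfadj_sqr // kckc2 => /(le_trans (norm_real_part ck ckk comm)).
  rewrite normrZ ger0_norm ?divr_ge0 // exprMn exprS => H.
  rewrite -(ler_pM2l (_ : 0 < (5 / 4) ^+ 2)) ?exprn_gt0 ?divr_gt0 //.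
  apply: le_trans H _; rewrite le_eqVlt; apply/orP; left; apply/eqP.
  by rewrite (exprS _ N); move: ((16 / 25) ^+ N) => X; field.
move=> kS k1; apply: norm_small0 => e e0.
have half01 : (0 <= (16 / 25 : C)) && ((16 / 25 : C) < 1).
  by rewrite divr_ge0 // ltr_pdivrMr // mul1r ltr_nat.
have e2 : 0 < e ^+ 2 / 2 by rewrite divr_gt0 // exprn_gt0.
have [N NE] := exprC_small half01 e2.
rewrite -(ler_pXn2r (ltn0Sn 1)) ?nnegrE ?(ltW e0) //.
rewrite (le_trans (bound N k kS k1)) // mulrC -ler_pdivlMr //.
exact: ltW.
Qed.

(** [1 + h^2] is the mean of [(1 + h)^2] and [(1 - h)^2], hence has norm at most 1, and
    [norm_one_addM_le1] applies. *)
Lemma norm_one_pm_le1 h : star h = h -> `|1 + h| <= 1 -> `|1 - h| <= 1 -> h = 0.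
Proof.
move=> hS h1 h2; apply: norm_one_addM_le1 => //.
have -> : 1 + h * h = (2^-1 : C) *: ((1 + h) * (1 + h) + (1 - h) * (1 - h)).
  have -> : (1 + h) * (1 + h) + (1 - h) * (1 - h) = (1 + h * h) + (1 + h * h).
    rewrite !mulrDr !mulr1 !mulrN !mulrDl !mul1r mulNr opprD opprK addrACA.
    rewrite [1 + h + _]addrACA subrr addr0 [h + _ + _]addrACA subrr add0r.
    by rewrite addrACA.
  rewrite -mulr2n -[X in _ *: X]scaler_nat scalerA mulVf ?scale1r //.
rewrite normrZ ger0_norm ?invr_ge0 // -(ler_pM2l (_ : 0 < 2)) // mulrA mulfV //.
rewrite mul1r mulr1 (le_trans (ler_normD _ _)) //.
rewrite [X in _ <= X](_ : _ = 1 * 1 + 1 * 1) ?mulr1 // lerD //.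
  by rewrite (le_trans (normrM_le _ _)) // -[X in _ <= X]mulr1 ler_pM.
by rewrite (le_trans (normrM_le _ _)) // -[X in _ <= X]mulr1 ler_pM.
Qed.

End CStar.

Section Contractive.
Variables (R : realType) (A B : cstarAlgType R).
Local Notation C := R[i].

(* A self-adjoint [a] with [`|a| < 1] is the real part of the unitary [a + 'i b],
   [b^2 = 1 - a^2], and *-homomorphisms preserve unitaries. *)
Lemma star_morphism_contractive (f : {lrmorphism A -> B}) (x : A) :
  star_preserving f -> `|f x| <= `|x|.
Proof.
move=> fS.
have unit_ball (a : A) : star a = a -> `|a| < 1 -> `|f a| <= 1.
  move=> aS a1.
  have aaS : star (a * a) = a * a by rewrite starM aS.
  have aa1 : `|a * a| < 1 by rewrite norm_selfadj_sqr // expr_lt1.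
  have [b [bS bb bx]] := sqrt_one_sub aaS aa1.
  have ab : a * b = b * a by apply: bx; rewrite mulrA.
  pose w := a + ('i : C) *: b.
  have w1 : star w * w = 1.
    by rewrite star_cartesian // cartesian_starM // bb subrKC.
  rewrite (real_part_cartesian aS bS) -/w.
  rewrite linearZ /= rmorphD /= normrZ ger0_norm ?invr_ge0 //.
  have fw : `|f w| = 1.
    by apply: norm_isometry; rewrite -fS -rmorphM w1 rmorph1.
  have fw' : `|f (star w)| = 1 by rewrite fS norm_star.
  rewrite -(ler_pM2l (_ : 0 < 2)) // mulrA mulfV // mul1r mulr1.
  by rewrite (le_trans (ler_normD _ _)) // fw fw'.
(* Dividing [star x * x] by [t ^+ 2], with [t] slightly above the norm of [x], gives a self-adjoint
   element of the open unit ball; the C*-identity in [B] then bounds [f x]. *)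
apply/ler_addgt0Pr => e e0; set t := `|x| + e.
have xt : `|x| < t by rewrite ltrDl.
have t0 : 0 < t by apply: le_lt_trans xt.
rewrite -(ler_pXn2r (ltn0Sn 1)) ?nnegrE // ?(ltW t0) //.
rewrite -norm_starM -fS -rmorphM.
pose s : C := (t ^+ 2)^-1.
have s0 : 0 < s by rewrite invr_gt0 exprn_gt0.
have := unit_ball (s *: (star x * x)).
rewrite linearZ /= !normrZ (ger0_norm (ltW s0)) norm_starM starZ starM starK.
rewrite mulrC ltr_pdivrMr ?exprn_gt0 // mul1r => H.
rewrite -[X in X <= _]mulr1 -(mulfV (_ : t ^+ 2 != 0)) ?expf_neq0 ?gt_eqF //.
rewrite mulrCA ler_piMr ?exprn_ge0 ?(ltW t0) // mulrC; apply: H.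
  by rewrite conj_Creal // ger0_real // ltW.
by rewrite ltrXn2r.
Qed.

End Contractive.

(** * Points of minimal norm *)

Lemma sum_norm2_limit (K : numFieldType) (I : finType) (x : nat -> I -> K)
    (l : I -> K) :
  (forall i (e : K), 0 < e ->
     exists N, forall n, (N <= n)%N -> `|l i - x n i| < e) ->
  forall e : K, 0 < e -> exists N, forall n, (N <= n)%N ->
    `|\sum_i `|l i| ^+ 2 - \sum_i `|x n i| ^+ 2| < e.
Proof.
move=> xl e e0.
have : (\sum_i `|x n i| ^+ 2) @[n --> \oo] --> \sum_i `|l i| ^+ 2.
  apply: cvg_big => [|i _]; first exact: add_continuous.
  apply: cvgM; apply: cvg_norm; apply/cvgrPdist_lt => e' e'0;
    by have [N hN] := xl i e' e'0; exists N.
by move=> /cvgrPdist_lt /(_ e e0) [N _ hN]; exists N.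
Qed.

Section MinNorm.
Variable R : realType.
Local Notation C := R[i].

Lemma complex_complete (x : nat -> C) :
  (forall e : C, 0 < e -> exists N, forall m n, (N <= m)%N -> (N <= n)%N ->
     `|x m - x n| < e) ->
  exists l, forall e : C, 0 < e -> exists N, forall n, (N <= n)%N ->
     `|l - x n| < e.
Proof.
move=> cx.
have normi : `|'i%C : C| = 1.
  by rewrite normc_def /= expr0n expr1n add0r sqrtr1.
have part (p : C -> R) : (forall y z, p (y - z) = p y - p z) ->
    (forall y, (`|p y|%:C)%C <= `|y|) ->
    exists l, forall e : R, 0 < e -> exists N, forall n, (N <= n)%N ->
      `|l - p (x n)| < e.
  move=> pB pn; apply: (@dist_complete _ R) => e e0.
  have [|N hN] := cx (e%:C)%C; first by rewrite ltcR.
  exists N => m n Nm Nn; rewrite -ltcR -pB.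
  by rewrite (le_lt_trans (pn _)) // hN.
have [||lr hr] := part (@complex.Re R).
- by case=> ? ? [].
- exact: normc_ge_Re.
have [||li hi] := part (@complex.Im R).
- by case=> ? ? [].
- move=> y; rewrite -normrN -ReiNIm (le_trans (normc_ge_Re _)) //.
  by rewrite normrM normi mulr1.
exists (lr +i* li)%C => e e0.
have [e1 eE] : exists e1, e = (e1%:C)%C.
  by apply/complex_realP; rewrite gtr0_real.
have e10 : 0 < e1 / 2 by rewrite divr_gt0 // -ltcR -eE.
have [N1 h1] := hr _ e10; have [N2 h2] := hi _ e10.
exists (maxn N1 N2) => n; rewrite geq_max => /andP [n1 n2].
rewrite [X in `|X|]complexE (le_lt_trans (ler_normD _ _)) //.
rewrite normrM normi mul1r.
have nR (r : R) : `|(r%:C)%C : C| = (`|r|%:C)%C.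
  by rewrite normc_def /= expr0n addr0 sqrtr_sqr.
move: (h1 n n1) (h2 n n2); rewrite !nR; case: (x n) => a b /= ha hb.
by rewrite -rmorphD eE ltcR [e1]splitr ltrD.
Qed.

(** The usual projection argument for a closed convex set: by the parallelogram identity a
    minimizing sequence is Cauchy, and the same identity gives uniqueness of the minimizer. *)
Lemma min_norm_point (I : finType) (K : (I -> C) -> Prop) :
  (exists c, K c) ->
  (forall c d, K c -> K d -> K (fun i => 2^-1 * (c i + d i))) ->
  (forall c, (forall e : C, 0 < e ->
     exists2 d, K d & forall i, `|c i - d i| <= e) -> K c) ->
  exists2 c, K c & forall d, K d ->
    \sum_i `|d i| ^+ 2 = \sum_i `|c i| ^+ 2 -> d =1 c.
Proof.
move=> [c0 Kc0] Kmid Kclosed.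
pose Q (c : I -> C) : C := \sum_i `|c i| ^+ 2.
have Q0 c : 0 <= Q c by apply: sumr_ge0 => i _; rewrite exprn_ge0.
have parall c d : Q (fun i => c i - d i) =
    2 * Q c + 2 * Q d - 4 * Q (fun i => 2^-1 * (c i + d i)).
  rewrite /Q !mulr_sumr -big_split -sumrB /=; apply: eq_bigr => i _.
  rewrite !normCK !(rmorphM, rmorphD, rmorphN, fmorphV, rmorph1) /=.
  by field.
pose E : set R := [set r | exists2 c, K c & Q c = (r%:C)%C].
have QR c : Q c = ((complex.Re (Q c))%:C)%C by rewrite RRe_real ?ger0_real.
have Elb : has_lbound E.
  by exists 0 => r [c _ Qc]; rewrite -lecR -Qc.
have Einf : has_inf E.
  by split=> //; exists (complex.Re (Q c0)); exists c0.
pose M : C := ((inf E)%:C)%C.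
have MQ c : K c -> M <= Q c.
  move=> Kc; rewrite /M QR lecR; apply: ge_inf => //.
  by exists c.
have Madh n : exists c, K c /\ Q c < M + 2^-1 ^+ n.
  have d0 : 0 < (2^-1 : R) ^+ n by rewrite exprn_gt0 // invr_gt0.
  have [r [c Kc Qc] lt] := inf_adherent d0 Einf.
  exists c; split=> //; move: lt; rewrite -ltcR -Qc rmorphD rmorphXn.
  by rewrite fmorphV rmorph_nat.
have /choice [x xP] := Madh.
have Kx n : K (x n) by case: (xP n).
have xQ n N : (N <= n)%N -> Q (x n) <= M + 2^-1 ^+ N.
  move=> Nn; case: (xP n) => _ /ltW /le_trans; apply; rewrite lerD2l.
  by rewrite ler_wiXn2l // ?invr_ge0 // invf_le1 // ler1n.
(* The midpoint of two terms lies in [K], so its squared norm is at least [M], and [parall] bounds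
   the distance of the terms. *)
have xdist N m n : (N <= m)%N -> (N <= n)%N ->
    Q (fun i => x m i - x n i) <= 4 * 2^-1 ^+ N.
  move=> Nm Nn; rewrite parall lerBlDr.
  apply: (@le_trans _ _ (4 * 2^-1 ^+ N + 4 * M)).
    have -> (a b : C) : 4 * a + 4 * b = 2 * (b + a) + 2 * (b + a) by ring.
    by rewrite lerD // ler_pM2l // xQ.
  by rewrite lerD2l ler_pM2l //; apply/MQ/Kmid.
have half01 : (0 <= 2^-1 :> C) && (2^-1 < 1 :> C).
  by rewrite invr_ge0 ler0n invf_lt1 ?ltr1n.
have xl i : exists l, forall e : C, 0 < e -> exists N, forall n, (N <= n)%N ->
    `|l - x n i| < e.
  apply: complex_complete => e e0.
  have [|N NE] := @exprC_small R _ (e ^+ 2 / 4) half01.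
    by rewrite divr_gt0 // exprn_gt0.
  exists N => m n Nm Nn; rewrite -(ltr_pXn2r (ltn0Sn 1)) ?nnegrE ?(ltW e0) //.
  apply: (@le_lt_trans _ _ (4 * 2^-1 ^+ N)); last first.
    by rewrite mulrC -ltr_pdivlMr.
  apply: le_trans (xdist N m n Nm Nn).
  by rewrite /Q (bigD1 i) //= lerDl sumr_ge0 // => j _; rewrite exprn_ge0.
have {xl} [l lP] := choice xl.
have Kl : K l.
  apply: Kclosed => e e0; have /choice [N NP] := fun i => lP i e e0.
  exists (x (\max_i N i)%N) => // i; apply/ltW/NP.
  exact: leq_bigmax.
have QlM : Q l <= M.
  apply/ler_addgt0Pr => e e0.
  have e20 : 0 < e / 2 by rewrite divr_gt0.
  have [N1 h1] := sum_norm2_limit lP e20.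
  have [N2 h2] := @exprC_small R _ _ half01 e20.
  set n := maxn N1 N2.
  rewrite -[Q l](subrKC (Q (x n))) [e]splitr [M + _]addrA.
  rewrite lerD //.
    apply: (le_trans (xQ n N2 (leq_maxr _ _))).
    by rewrite lerD2l ltW.
  apply: (@le_trans _ _ `|Q l - Q (x n)|).
    by rewrite real_ler_norm // rpredB // ger0_real.
  by apply/ltW/h1/leq_maxl.
exists l => // d Kd Qdl i.
(* As [Q d = Q l], the parallelogram identity gives four times [Q l] minus the squared norm of the
   midpoint, and that difference is nonpositive by minimality of [l]. *)
have : Q (fun i => d i - l i) <= 0.
  rewrite parall -/(Q d) [Q d]Qdl -mulrDl -natrD -/(Q l) -mulrBr.
  rewrite pmulr_rle0 // subr_le0 (le_trans QlM) // MQ //.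
  exact: Kmid.
move=> Qle; have /eqP : Q (fun i => d i - l i) = 0.
  by apply/le_anti; rewrite Qle Q0.
rewrite psumr_eq0 => [|j _]; last by rewrite exprn_ge0.
move=> /allP /(_ i (mem_index_enum i)) /=.
by rewrite expf_eq0 /= normr_eq0 subr_eq0 => /eqP.
Qed.
End MinNorm.

(** * Closed linear spans and orthogonality of the Cuntz isometries *)

Section LinSpan.
Variables (R : realType) (A : cstarAlgType R).
Local Notation C := R[i].
Implicit Types (D E : set A) (x y : A).

Lemma lin_span_gen D x : D x -> lin_span D x.
Proof.
move=> Dx; exists 1%N, (fun=> 1), (fun=> x); split=> //.
by rewrite big_ord1 scale1r.
Qed.

Lemma lin_span0 D : lin_span D 0.
Proof.
exists 0%N, (fun=> 0), (fun=> 0); split; first by case.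
by rewrite big_ord0.
Qed.

Lemma lin_spanZ D (c : C) x : lin_span D x -> lin_span D (c *: x).
Proof.
move=> [m [a [d [dD ->]]]]; exists m, (fun i => c * a i), d; split=> //.
by rewrite scaler_sumr; apply: eq_bigr => i _; rewrite scalerA.
Qed.

Lemma lin_spanD D x y : lin_span D x -> lin_span D y -> lin_span D (x + y).
Proof.
move=> [m [a [d [dD ->]]]] [p [b [e [eD ->]]]].
exists (m + p)%N, (fun i => match fintype.split i with inl j => a j | inr j => b j end),
  (fun i => match fintype.split i with inl j => d j | inr j => e j end); split.
  by move=> i; case: (fintype.split i).
rewrite big_split_ord; congr (_ + _); apply: eq_bigr => i _.
  by rewrite (fintype.unsplitK (inl i)).
by rewrite (fintype.unsplitK (inr i)).
Qed.

Lemma lin_span_sum D (I : Type) (r : seq I) (P : pred I) (F : I -> A) :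
  (forall i, P i -> lin_span D (F i)) -> lin_span D (\sum_(i <- r | P i) F i).
Proof. exact: (big_ind _ (lin_span0 D) (@lin_spanD D)). Qed.

Lemma lin_span_min D (P : A -> Prop) :
  (forall x, D x -> P x) -> P 0 -> (forall x y, P x -> P y -> P (x + y)) ->
  (forall (c : C) x, P x -> P (c *: x)) -> forall x, lin_span D x -> P x.
Proof.
move=> PD P0 Padd PZ x [m [a [d [dD ->]]]].
by apply: big_ind => // i _; apply/PZ/PD.
Qed.

Lemma lin_span_sub D E : D `<=` lin_span E -> lin_span D `<=` lin_span E.
Proof.
move=> DE; apply: lin_span_min => //; first exact: lin_span0.
  exact: lin_spanD.
exact: lin_spanZ.
Qed.

Lemma lin_spanM D :
  (forall x y, D x -> D y -> lin_span D (x * y)) ->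
  forall x y, lin_span D x -> lin_span D y -> lin_span D (x * y).
Proof.
move=> DM x y Dx; move: y; move: x Dx; apply: lin_span_min.
- move=> x Dx; apply: lin_span_min => [y Dy||y z|c y].
  + exact: DM.
  + by rewrite mulr0; apply: lin_span0.
  + by rewrite mulrDr; apply: lin_spanD.
  + by rewrite -scalerAr; apply: lin_spanZ.
- by move=> y _; rewrite mul0r; apply: lin_span0.
- by move=> x y hx hy z Dz; rewrite mulrDl; apply: lin_spanD; [apply: hx|apply: hy].
- by move=> c x hx z Dz; rewrite -scalerAl; apply/lin_spanZ/hx.
Qed.

Lemma lin_span_star D : (forall x, D x -> lin_span D (star x)) ->
  forall x, lin_span D x -> lin_span D (star x).
Proof.
move=> DS; apply: lin_span_min => [x|| x y|c x].
- exact: DS.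
- by rewrite star0; apply: lin_span0.
- by rewrite starD; apply: lin_spanD.
- by rewrite starZ; apply: lin_spanZ.
Qed.

(** Turns algebraic closure of a spanning set into the hypothesis of [cuntz_gen], from which density
    follows. *)
Lemma closure_star_subalgebra D : D 1 ->
  (forall x y, D x -> D y -> lin_span D (x * y)) ->
  (forall x, D x -> lin_span D (star x)) ->
  closed_star_subalgebra (closure (lin_span D)).
Proof.
move=> D1 DM DS; split.
- exact: closed_closure.
- exact/subset_closure/lin_span_gen.
- move=> x y /closure_distP hx /closure_distP hy; apply/closure_distP => e e0.
  have e20 : 0 < e / 2 by rewrite divr_gt0.
  have [x' Dx xx] := hx _ e20; have [y' Dy yy] := hy _ e20.
  exists (x' + y'); first exact: lin_spanD.
  by rewrite opprD addrACA [e]splitr (le_lt_trans (ler_normD _ _)) // ltrD.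
- move=> c x /closure_distP hx; apply/closure_distP => e e0.
  have c1 : 0 < 1 + `|c| by rewrite ltr_wpDr.
  have [|x' Dx xx] := hx (e / (1 + `|c|)); first by rewrite divr_gt0.
  exists (c *: x'); first exact: lin_spanZ.
  rewrite -scalerBr normrZ (@le_lt_trans _ _ ((1 + `|c|) * `|x - x'|)) //.
    by rewrite ler_wpM2r // lerDr ler01.
  by rewrite mulrC -ltr_pdivlMr.
- move=> x y /closure_distP hx /closure_distP hy; apply/closure_distP => e e0.
  have e20 : 0 < e / 2 by rewrite divr_gt0.
  have y1 : 0 < 1 + `|y| by rewrite ltr_wpDr.
  (* [x'] is chosen first, with a tolerance depending on [y], because the tolerance for [y'] depends
     on [x']. *)
  have [|x' Dx xx] := hx (e / 2 / (1 + `|y|)); first by rewrite divr_gt0.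
  have x1 : 0 < 1 + `|x'| by rewrite ltr_wpDr.
  have [|y' Dy yy] := hy (e / 2 / (1 + `|x'|)); first by rewrite divr_gt0.
  exists (x' * y'); first exact: lin_spanM.
  have -> : x * y - x' * y' = (x - x') * y + x' * (y - y').
    by rewrite mulrBl mulrBr addrA subrK.
  rewrite [e]splitr (le_lt_trans (ler_normD _ _)) // ltrD //.
    rewrite (le_lt_trans (normrM_le _ _)) //.
    rewrite (@le_lt_trans _ _ (`|x - x'| * (1 + `|y|))) //.
      by rewrite ler_wpM2l // lerDr ler01.
    by rewrite -ltr_pdivlMr.
  rewrite (le_lt_trans (normrM_le _ _)) //.
  rewrite (@le_lt_trans _ _ ((1 + `|x'|) * `|y - y'|)) //.
    by rewrite ler_wpM2r // lerDr ler01.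
  by rewrite mulrC -ltr_pdivlMr.
- move=> x /closure_distP hx; apply/closure_distP => e /hx [y Dy xy].
  exists (star y); first exact: lin_span_star.
  by rewrite -starB norm_star.
Qed.
End LinSpan.

Section Cuntz.
Variables (R : realType) (A : cstarAlgType R) (n : nat) (S : 'I_n -> A).
Local Notation C := R[i].
Hypothesis hS : cuntz_family S.

Let SS i : star (S i) * S i = 1. Proof. by case: hS. Qed.

Lemma norm_projection_le1 (q : A) : star q = q -> q * q = q -> `|q| <= 1.
Proof.
move=> qS qq; have := norm_starM q; rewrite qS qq expr2 => qE.
have [->|q0] := eqVneq q 0; first by rewrite normr0.
have q0' : `|q| != 0 by rewrite normr_eq0.
by rewrite (mulfI q0' (etrans (esym qE) (esym (mulr1 _)))).
Qed.

(* Orthogonality of the ranges is a consequence of [\sum_k S_k S_k^* = 1]: the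
   elements [e k = S_i^* S_k S_k^* S_i], [k != i], sum to zero and satisfy
   [`|1 - e k| <= 1], which by [norm_one_pm_le1] forces each of them to vanish. *)
Lemma cuntz_orth i j : star (S i) * S j = (i == j)%:R.
Proof.
case: eqVneq => [->|ij]; first exact: SS.
pose e k := star (S i) * (S k * star (S k)) * S i.
have eS k : star (e k) = e k by rewrite /e !starM !starK !mulrA.
have esum : \sum_(k | k != i) e k = 0.
  have : \sum_k e k = 1.
    by rewrite /e -mulr_suml -mulr_sumr (proj2 hS) mulr1.
  rewrite (bigD1 i) //= /e mulrA SS mul1r SS => /eqP.
  by rewrite eq_sym addrC -subr_eq subrr eq_sym => /eqP.
have e1 k : `|1 - e k| <= 1.
  have -> : 1 - e k = star (S i) * (1 - S k * star (S k)) * S i.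
    by rewrite mulrBr mulr1 mulrBl SS.
  rewrite (le_trans (normrM_le _ _)) // (norm_isometry (SS _)) mulr1.
  rewrite (le_trans (normrM_le _ _)) // norm_star (norm_isometry (SS _)) mul1r.
  apply: norm_projection_le1; first by rewrite starB star1 starM starK.
  rewrite mulrBr mulr1 mulrBl mul1r !mulrA -[S k * star (S k) * S k]mulrA.
  by rewrite SS mulr1 subrr subr0.
have n0 : (0 < n)%N by apply: leq_ltn_trans (ltn_ord i).
have nC : 0 < (n%:R : C) by rewrite ltr0n.
(* After division by [n], both [1 + h] and [1 - h] become means of [n] elements of norm at most
   1. *)
pose h := (n%:R^-1 : C) *: e j.
have h0 : h = 0.
  apply: norm_one_pm_le1.
  - by rewrite starZ eS fmorphV /= conjC_nat.
  (* As the [e k] with [k != i] sum to zero, [e j] is minus the sum of the others; each of these is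
     absorbed in a contraction [1 - e k]. *)
  - have -> : 1 + h = (n%:R^-1 : C) *: (\sum_(k | k != j)
        (if k == i then 1 else 1 - e k) + 1).
      rewrite [X in _ *: X](_ : _ = n%:R *: 1 + e j).
        by rewrite scalerDr scalerA mulVf ?gt_eqF // scale1r.
      have : e j = - \sum_(k | (k != i) && (k != j)) e k.
        apply/eqP; rewrite -addr_eq0; apply/eqP.
        by rewrite -[RHS]esum [RHS](bigD1 j) //= eq_sym.
      move=> ->; rewrite (bigD1 i) //= eqxx.
      under eq_bigr => k /andP [_ /negPf ki] do rewrite ki.
      rewrite sumrB addrAC addrA; congr (_ - _); last first.
        by apply: eq_bigl => k; rewrite andbC.
      transitivity (\sum_(k : 'I_n) (1 : A)); last first.
        by rewrite sumr_const card_ord scaler_nat.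
      by rewrite [RHS](bigD1 j) //= [X in _ = 1 + X](bigD1 i) //= addrA.
    rewrite normrZ ger0_norm ?invr_ge0 ?ler0n // mulrC ler_pdivrMr // mul1r.
    rewrite (le_trans (ler_normD _ _)) // norm_one.
    apply: (@le_trans _ _ (\sum_(k | k != j) 1 + 1)).
      rewrite lerD2r (le_trans (ler_norm_sum _ _ _)) // ler_sum // => k _.
      by case: ifP => _; rewrite ?norm_one.
    have -> : (n%:R : C) = \sum_(k : 'I_n) 1 by rewrite sumr_const card_ord.
    by rewrite [X in _ <= X](bigD1 j) //= addrC.
  - have -> : 1 - h = (n%:R^-1 : C) *: ((n.-1)%:R *: 1 + (1 - e j)).
      rewrite [X in _ *: X](_ : _ = n%:R *: 1 - e j).
        by rewrite scalerBr scalerA mulVf ?gt_eqF // scale1r.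
      by rewrite -[in RHS](prednK n0) -natr1 scalerDl scale1r addrA.
    rewrite normrZ ger0_norm ?invr_ge0 ?ler0n // mulrC ler_pdivrMr // mul1r.
    rewrite (le_trans (ler_normD _ _)) // normrZ norm_one mulr1 ger0_norm //.
    by rewrite -{2}(prednK n0) mulrSr lerD2l.
have : e j = 0.
  have -> : e j = (n%:R : C) *: h by rewrite scalerA mulfV ?gt_eqF // scale1r.
  by rewrite h0 scaler0.
(* By the C*-identity, [e j = 0] forces [star (S j) * S i = 0]. *)
have -> : e j = star (star (S j) * S i) * (star (S j) * S i).
  by rewrite starM starK /e !mulrA.
move=> /(congr1 Num.norm); rewrite norm_starM normr0 => /eqP.
rewrite expf_eq0 normr_eq0 /= => /eqP /(congr1 (@star R A)).
by rewrite starM starK star0.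
Qed.

End Cuntz.

(** * Words in the Cuntz isometries *)

Section Words.
Variables (R : realType) (A : cstarAlgType R) (n : nat) (S : 'I_n -> A).
Local Notation C := R[i].
Hypothesis hS : cuntz_family S.

Definition word_elt (s : seq 'I_n) : A := \prod_(i <- s) S i.

Lemma word_elt_cons i s : word_elt (i :: s) = S i * word_elt s.
Proof. exact: big_cons. Qed.

Lemma word_elt_cat s t : word_elt (s ++ t) = word_elt s * word_elt t.
Proof. exact: big_cat. Qed.

Lemma word_elt_isometry s : star (word_elt s) * word_elt s = 1.
Proof.
elim: s => [|i s IH]; first by rewrite /word_elt big_nil star1 mulr1.
rewrite word_elt_cons starM -mulrA (mulrA (star (S i))).
by rewrite (proj1 hS) mul1r.
Qed.

(** Equal first letters cancel and distinct ones give zero by orthogonality; otherwise one word is a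
    prefix of the other and the rest of the longer one remains. *)
Lemma star_word_mul t s :
  [\/ star (word_elt t) * word_elt s = 0,
      exists r, star (word_elt t) * word_elt s = word_elt r |
      exists r, star (word_elt t) * word_elt s = star (word_elt r)].
Proof.
elim: t s => [|i t IH] s.
  by constructor 2; exists s; rewrite {1}/word_elt big_nil star1 mul1r.
case: s => [|j s].
  by constructor 3; exists (i :: t); rewrite {2}/word_elt big_nil mulr1.
rewrite !word_elt_cons starM -mulrA (mulrA (star (S i))) (cuntz_orth hS).
case: eqP => _; first by rewrite mul1r.
by constructor 1; rewrite mul0r mulr0.
Qed.

Lemma word_elt_sum k :
  \sum_(t : k.-tuple 'I_n) word_elt t * star (word_elt t) = 1.
Proof.
elim: k => [|k IH].
  rewrite (bigD1 [tuple]) //= big1 => [|t /eqP []]; last exact: tuple0.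
  by rewrite /word_elt big_nil star1 mulr1 addr0.
rewrite (reindex (fun p : 'I_n * k.-tuple 'I_n => [tuple of p.1 :: p.2])) /=.
  rewrite -(pair_big xpredT xpredT (fun i (t : k.-tuple 'I_n) =>
    word_elt (i :: t) * star (word_elt (i :: t)))) /=.
  rewrite -(proj2 hS); apply: eq_bigr => i _.
  under eq_bigr => t _ do
    rewrite word_elt_cons starM mulrA -(mulrA (S i)).
  by rewrite -mulr_suml -mulr_sumr IH mulr1.
exists (fun t => (thead t, [tuple of behead t])) => [[i t]|t] _ /=.
  by congr (_, _); apply: val_inj.
by rewrite -tuple_eta.
Qed.

Definition monomials : set A :=
  [set x | exists s t, x = word_elt s * star (word_elt t)].

Lemma monomials_dense : cuntz_algebra S -> closure (lin_span monomials) = setT.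
Proof.
move=> [_ gen _]; apply: gen.
  apply: closure_star_subalgebra.
  - by exists [::], [::]; rewrite /word_elt big_nil star1 mulr1.
  - move=> _ _ [s [t ->]] [s' [t' ->]].
    rewrite -mulrA (mulrA (star (word_elt t))).
    case: (star_word_mul t s') => [->|[r ->]|[r ->]].
    + by rewrite mul0r mulr0; apply: lin_span0.
    + apply: lin_span_gen; exists (s ++ r), t'.
      by rewrite word_elt_cat mulrA.
    + apply: lin_span_gen; exists s, (t' ++ r).
      by rewrite word_elt_cat starM.
  - move=> _ [s [t ->]]; apply: lin_span_gen; exists t, s.
    by rewrite starM starK.
move=> i; apply/subset_closure/lin_span_gen; exists [:: i], [::].
by rewrite /word_elt big_seq1 big_nil star1 mulr1.
Qed.

Section Level.
Variable k : nat.
Local Notation word := (k.-tuple 'I_n).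
Implicit Types (c : word * word -> C) (v w : word).

(** [c] is read as a matrix indexed by words: the [S_v S_w^*] with both words of length [k] multiply
    like matrix units. *)
Definition kernel_elt c : A :=
  \sum_p c p *: (word_elt p.1 * star (word_elt p.2)).

(** A crude bound that makes [kernel_elt] continuous in the coefficients. *)
Lemma norm_kernel_elt c : `|kernel_elt c| <= \sum_p `|c p|.
Proof.
rewrite (le_trans (ler_norm_sum _ _ _)) // ler_sum // => p _.
rewrite normrZ ler_piMr // (le_trans (normrM_le _ _)) // norm_star.
by rewrite !(norm_isometry (word_elt_isometry _)) mulr1.
Qed.

Lemma kernel_eltD c d :
  kernel_elt (fun p => c p + d p) = kernel_elt c + kernel_elt d.
Proof. by rewrite -big_split; apply: eq_bigr => p _; rewrite scalerDl. Qed.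

Lemma kernel_eltZ (a : C) c : kernel_elt (fun p => a * c p) = a *: kernel_elt c.
Proof. by rewrite scaler_sumr; apply: eq_bigr => p _; rewrite scalerA. Qed.

Lemma eq_kernel_elt c d : c =1 d -> kernel_elt c = kernel_elt d.
Proof. by move=> cd; apply: eq_bigr => p _; rewrite cd. Qed.

Definition level_elt (x : A) := exists c, x = kernel_elt c.

Lemma level_eltD x y : level_elt x -> level_elt y -> level_elt (x + y).
Proof.
by move=> [c ->] [d ->]; exists (fun p => c p + d p); rewrite kernel_eltD.
Qed.

Lemma level_eltZ (a : C) x : level_elt x -> level_elt (a *: x).
Proof. by move=> [c ->]; exists (fun p => a * c p); rewrite kernel_eltZ. Qed.

Lemma level_elt0 : level_elt 0.
Proof.
by exists (fun=> 0); rewrite /kernel_elt big1 // => p _; rewrite scale0r.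
Qed.

Lemma level_elt_unit s t : size s = k -> size t = k ->
  level_elt (word_elt s * star (word_elt t)).
Proof.
have tupleE (r : seq 'I_n) : size r = k -> exists w : word, r = w.
  by move=> rk; subst k; exists (in_tuple r).
move=> /tupleE [v ->] /tupleE [w ->]; exists (fun p => (p == (v, w))%:R).
rewrite /kernel_elt (bigD1 (v, w)) //= eqxx scale1r big1 ?addr0 // => p.
by move=> /negPf ->; rewrite scale0r.
Qed.

End Level.

(** Inserting [1 = \sum_r S_r S_r^*] over words [r] of length [m - k] between the two factors embeds
    level [k] in level [m]. *)
Lemma level_elt_raise k m s t : (k <= m)%N -> size s = k -> size t = k ->
  level_elt m (word_elt s * star (word_elt t)).
Proof.
move=> km sk tk.
rewrite -[word_elt s]mulr1 -(word_elt_sum (m - k)) mulr_sumr mulr_suml.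
apply: (big_ind _ (level_elt0 m) (@level_eltD m)) => r _.
rewrite mulrA -mulrA -starM -!word_elt_cat.
by apply: level_elt_unit; rewrite size_cat size_tuple ?sk ?tk subnKC.
Qed.
End Words.

(** * Bogolyubov automorphisms *)

Lemma unitarymx_rows (C : numClosedFieldType) (n : nat) (a : 'M[C]_n) i j :
  a \is unitarymx -> \sum_k a i k * (a j k)^* = (i == j)%:R.
Proof.
move=> /unitarymxP /matrixP /(_ i j); rewrite !mxE => <-.
by apply: eq_bigr => k _; rewrite !mxE.
Qed.

Lemma unitarymx_cols (C : numClosedFieldType) (n : nat) (a : 'M[C]_n) i j :
  a \is unitarymx -> \sum_k (a k i)^* * a k j = (i == j)%:R.
Proof.
move=> /unitarymxP /mulmx1C /matrixP /(_ i j); rewrite !mxE => <-.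
by apply: eq_bigr => k _; rewrite !mxE.
Qed.

Lemma tensor_pow_adj (C : numClosedFieldType) (n k : nat) (a : 'M[C]_n)
    (v w : k.-tuple 'I_n) :
  tensor_pow (a ^t*) v w = (tensor_pow a w v)^*.
Proof. by rewrite /tensor_pow rmorph_prod; apply: eq_bigr => i _; rewrite !mxE. Qed.

Lemma tensor_pow1 (C : numClosedFieldType) (n k : nat) (v w : k.-tuple 'I_n) :
  tensor_pow (1%:M : 'M[C]_n) v w = (v == w)%:R.
Proof.
rewrite -diag_const_mx tensor_pow_diag big1 ?mulr1 // => i _.
by rewrite mxE.
Qed.

Lemma tensor_pow_rows (C : numClosedFieldType) (n k : nat) (a : 'M[C]_n)
    (v w : k.-tuple 'I_n) : a \is unitarymx ->
  \sum_x tensor_pow a v x * (tensor_pow a w x)^* = (v == w)%:R.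
Proof.
move=> /unitarymxP aa; rewrite -(tensor_pow1 C) -aa tensor_powM.
by apply: eq_bigr => x _; rewrite tensor_pow_adj.
Qed.

Lemma tensor_pow_cols (C : numClosedFieldType) (n k : nat) (a : 'M[C]_n)
    (v w : k.-tuple 'I_n) : a \is unitarymx ->
  \sum_x (tensor_pow a x v)^* * tensor_pow a x w = (v == w)%:R.
Proof.
move=> /unitarymxP /mulmx1C aa; rewrite -(tensor_pow1 C) -aa tensor_powM.
by apply: eq_bigr => x _; rewrite tensor_pow_adj.
Qed.

Lemma sum_norm2_isometry (C : numClosedFieldType) (T : finType)
    (V : T -> T -> C) (x : T -> C) :
  (forall v w, \sum_t (V t v)^* * V t w = (v == w)%:R) ->
  \sum_t `|\sum_v V t v * x v| ^+ 2 = \sum_v `|x v| ^+ 2.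
Proof.
move=> Vorth.
transitivity (\sum_t \sum_v \sum_w (V t v)^* * V t w * ((x v)^* * x w)).
  apply: eq_bigr => t _; rewrite normCK mulrC rmorph_sum mulr_suml.
  apply: eq_bigr => v _; rewrite mulr_sumr; apply: eq_bigr => w _.
  by rewrite rmorphM mulrACA.
rewrite exchange_big; apply: eq_bigr => v _ /=; rewrite exchange_big /=.
under eq_bigr => w _ do rewrite -mulr_suml Vorth.
rewrite (bigD1 v) //= eqxx mul1r big1 ?addr0 => [|w]; first by rewrite mulrC -normCK.
by rewrite eq_sym => /negPf ->; rewrite mul0r.
Qed.

Section Bogolyubov.
Variables (R : realType) (A : cstarAlgType R) (n : nat) (S : 'I_n -> A).
Local Notation C := R[i].
Implicit Types (a : 'M[C]_n) (b : {lrmorphism A -> A}).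

(** The matrix form of a Bogolyubov automorphism: the columns of [a] are the coordinates of the
    elements [z S_j]. *)
Definition implements a b : Prop :=
  star_preserving b /\ forall j, b (S j) = \sum_i a i j *: S i.

Hypothesis hS : cuntz_family S.

Let col a j := \sum_i a i j *: S i.

Let col_orth a i j :
  star (col a i) * col a j = (\sum_k (a k i)^* * a k j)%:A.
Proof.
rewrite star_sum mulr_suml scaler_suml; apply: eq_bigr => k _.
rewrite starZ mulr_sumr (bigD1 k) //= big1 ?addr0 => [|l].
  by rewrite -scalerAl -scalerAr (cuntz_orth hS) eqxx scalerA.
rewrite eq_sym => /negPf kl.
by rewrite -scalerAl -scalerAr (cuntz_orth hS) kl !scaler0.
Qed.

Lemma bogolyubov_exists a : cuntz_algebra S -> a \is unitarymx ->
  exists2 b, bogolyubov S b & implements a b.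
Proof.
(* [z] is the copy of [a] in the span of the [S_i S_j^*]. Orthonormality of the columns of [a] gives
   [star z * z = 1], that of the rows gives [z * star z = 1]. *)
move=> hC aU; pose z := \sum_j col a j * star (S j).
have zS j : z * S j = col a j.
  rewrite mulr_suml (bigD1 j) //= -mulrA (cuntz_orth hS) eqxx mulr1.
  rewrite big1 ?addr0 // => i /negPf ij.
  by rewrite -mulrA (cuntz_orth hS) ij mulr0.
have zU : unitary z.
  split.
    rewrite {2}/z mulr_sumr -(proj2 hS); apply: eq_bigr => j _.
    rewrite mulrA; congr (_ * _); rewrite star_sum mulr_suml (bigD1 j) //=.
    rewrite starM starK -mulrA col_orth unitarymx_cols // eqxx scale1r mulr1.
    rewrite big1 ?addr0 // => i /negPf ij.
    by rewrite starM starK -mulrA col_orth unitarymx_cols // ij scale0r mulr0.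
  rewrite {1}/z mulr_suml.
  under eq_bigr => j _ do rewrite -mulrA -starM zS.
  transitivity (\sum_i \sum_l (\sum_j a i j * (a l j)^*) *: (S i * star (S l))).
    under [RHS]eq_bigr => i _ do under eq_bigr => l _ do rewrite scaler_suml.
    under [RHS]eq_bigr => i _ do rewrite exchange_big.
    rewrite [RHS]exchange_big /=; apply: eq_bigr => j _.
    rewrite mulr_suml; apply: eq_bigr => i _.
    rewrite star_sum mulr_sumr; apply: eq_bigr => l _.
    by rewrite starZ -scalerAl -scalerAr scalerA.
  rewrite -(proj2 hS); apply: eq_bigr => i _.
  rewrite (bigD1 i) //= unitarymx_rows // eqxx scale1r big1 ?addr0 // => l.
  by rewrite eq_sym => /negPf il; rewrite unitarymx_rows // il scale0r.
have [b [[bS bE] _]] := cuntz_endo_exists hC zU.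
exists b; last by split=> // j; rewrite bE zS.
exists z; split=> //.
apply: lin_span_sum => j _; rewrite mulr_suml; apply: lin_span_sum => i _.
by rewrite -scalerAl; apply/lin_spanZ/lin_span_gen; exists i, j.
Qed.

Lemma bogolyubov_matrix b : bogolyubov S b ->
  exists2 a, a \is unitarymx & implements a b.
Proof.
move=> [z [[zz _] zF [bS bE]]].
have [a zE] : exists a, forall j, z * S j = col a j.
  move: z {zz bE} zF; apply: lin_span_min.
  - move=> _ [p [q ->]]; exists (delta_mx p q) => j.
    rewrite -mulrA (cuntz_orth hS) eq_sym /col (bigD1 p) //= mxE eqxx.
    rewrite big1 ?addr0 => [|i /negPf ip].
      by rewrite andTb; case: eqP; rewrite ?mulr1 ?mulr0 ?scale1r ?scale0r.
    by rewrite mxE ip scale0r.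
  - by exists 0 => j; rewrite mul0r /col big1 // => i _; rewrite mxE scale0r.
  - move=> x y [a xE] [d yE]; exists (a + d) => j.
    rewrite mulrDl xE yE -big_split; apply: eq_bigr => i _ /=.
    by rewrite mxE scalerDl.
  - move=> c x [a xE]; exists (c *: a) => j.
    rewrite -scalerAl xE scaler_sumr; apply: eq_bigr => i _.
    by rewrite mxE scalerA.
(* [star z * z = 1] makes the columns of [a] orthonormal, which is unitarity for a square matrix. *)
exists a; last by split=> // j; rewrite bE zE.
apply/unitarymxP/mulmx1C/matrixP => i j; rewrite !mxE.
under eq_bigr => k _ do rewrite !mxE.
have : star (col a i) * col a j = (i == j)%:R.
  by rewrite -!zE starM mulrA -(mulrA (star (S i))) zz mulr1 (cuntz_orth hS).
rewrite col_orth => /eqP.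
have -> : ((i == j)%:R : A) = ((i == j)%:R : C)%:A.
  by rewrite scaler_nat.
by rewrite -subr_eq0 -scalerBl scaler_eq0 oner_eq0 orbF subr_eq0 => /eqP.
Qed.

Section Level.
Variables (k : nat) (a : 'M[C]_n) (b : {lrmorphism A -> A}).
Hypotheses (aU : a \is unitarymx) (ab : implements a b).
Local Notation word := (k.-tuple 'I_n).
Implicit Types (c : word * word -> C) (v w : word).

Lemma implements_word w :
  b (word_elt S w) = \sum_v tensor_pow a v w *: word_elt S v.
Proof.
rewrite /word_elt rmorph_prod big_tuple.
transitivity (\prod_(i < k) \sum_j a j (tnth w i) *: S j).
  by apply: eq_bigr => i _; apply: (proj2 ab).
rewrite (prod_sum_tuple (fun i j => a j (tnth w i) *: S j)).
apply: eq_bigr => v _; rewrite scaler_prod big_tuple.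
by congr (_ *: _).
Qed.

(** Conjugation of the matrix [c] by the tensor power of [a]. *)
Definition conj_kernel c : word * word -> C := fun p =>
  \sum_x tensor_pow a p.1 x * \sum_y (tensor_pow a p.2 y)^* * c (x, y).

Lemma implements_kernel c : b (kernel_elt S c) = kernel_elt S (conj_kernel c).
Proof.
rewrite /kernel_elt linear_sum /=.
under eq_bigr => p _ do
  rewrite linearZ /= rmorphM /= (proj1 ab) !implements_word star_sum mulr_suml.
under eq_bigr => p _ do under eq_bigr => v _ do rewrite mulr_sumr.
under eq_bigr => p _ do rewrite (pair_big xpredT xpredT) /= scaler_sumr.
rewrite exchange_big /=; apply: eq_bigr => -[v w] _ /=.
rewrite /conj_kernel /= scaler_suml.
under [RHS]eq_bigr => x _ do rewrite mulr_sumr scaler_suml.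
rewrite (pair_big xpredT xpredT) /=; apply: eq_bigr => -[x y] _ /=.
rewrite starZ -scalerAl -scalerAr !scalerA; congr (_ *: _).
by rewrite -mulrA mulrC -mulrA.
Qed.

(** Unitary invariance of the Hilbert-Schmidt norm, applied to the two indices in turn. *)
Lemma sum_norm2_conj_kernel c :
  \sum_p `|conj_kernel c p| ^+ 2 = \sum_p `|c p| ^+ 2.
Proof.
rewrite -(pair_big xpredT xpredT (fun v w => `|conj_kernel c (v, w)| ^+ 2)) /=.
rewrite exchange_big /= /conj_kernel /=.
under eq_bigr => w _ do rewrite (sum_norm2_isometry
  (fun x => \sum_y (tensor_pow a w y)^* * c (x, y))
  (fun v w => tensor_pow_cols v w aU)).
rewrite exchange_big /=.
transitivity (\sum_p `|c (p.1, p.2)| ^+ 2); last first.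
  by apply: eq_bigr => -[v w] _.
rewrite -(pair_big xpredT xpredT (fun v w => `|c (v, w)| ^+ 2)) /=.
apply: eq_bigr => x _ /=.
rewrite (sum_norm2_isometry (V := fun w y => (tensor_pow a w y)^*)
  (fun y => c (x, y))) // => v w.
rewrite -[RHS]conjC_nat -(tensor_pow_cols v w aU) rmorph_sum.
by apply: eq_bigr => t _; rewrite rmorphM.
Qed.

Lemma conj_kernel_fixed_comm c : conj_kernel c =1 c ->
  kcomm (fun v w => c (v, w)) (tensor_pow a).
Proof.
move=> cfix v w; rewrite /kmul.
under eq_bigr => z _ do rewrite -cfix /conj_kernel /= mulr_suml.
rewrite exchange_big /=; apply: eq_bigr => x _.
under eq_bigr => z _ do rewrite -mulrA mulr_suml.
rewrite -mulr_sumr exchange_big /=; congr (_ * _).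
under eq_bigr => y _ do under eq_bigr => z _ do rewrite mulrAC.
under eq_bigr => y _ do rewrite -mulr_suml tensor_pow_cols //.
rewrite (bigD1 w) //= eqxx mul1r big1 ?addr0 // => y /negPf ->.
exact: mul0r.
Qed.

Definition act_kernel (s : 'S_k) : word * word -> C :=
  fun p => (p.1 == word_act s p.2)%:R.

(** Permuting tensor factors commutes with a tensor power: in [shift], reindexing the product over
    positions moves [s] from the column word to the row word as [s^-1]. *)
Lemma conj_act_kernel s : conj_kernel (act_kernel s) =1 act_kernel s.
Proof.
move=> [v w]; rewrite /conj_kernel /act_kernel /=.
transitivity (\sum_y tensor_pow a v (word_act s y) * (tensor_pow a w y)^*).
  under eq_bigr => x _ do rewrite mulr_sumr.
  rewrite exchange_big /=; apply: eq_bigr => y _.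
  rewrite (bigD1 (word_act s y)) //= eqxx mulr1 big1 ?addr0 // => x /negPf ->.
  by rewrite !mulr0.
have shift y : tensor_pow a v (word_act s y) = tensor_pow a (word_act s^-1%g v) y.
  rewrite /tensor_pow (reindex_inj (@perm_inj _ s^-1%g)) /=.
  by apply: eq_bigr => i _; rewrite !tnth_mktuple permKV.
under eq_bigr => y _ do rewrite shift.
rewrite tensor_pow_rows //; congr (_%:R); congr nat_of_bool.
apply/eqP/eqP => [<-|->]; by rewrite word_actM ?mulgV ?mulVg word_act1.
Qed.

End Level.

Lemma kernel_elt_act (k : nat) (s : 'S_k) :
  kernel_elt S (act_kernel s) = perm_unitary S (perm (@word_act_inj n k s)).
Proof.
rewrite /kernel_elt -(pair_big xpredT xpredT (fun v w => act_kernel s (v, w) *: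
  (word_elt S v * star (word_elt S w)))) exchange_big /=.
apply: eq_bigr => w _; rewrite (bigD1 (word_act s w)) //= big1 ?addr0.
  by rewrite /act_kernel eqxx scale1r permE.
by move=> v /negPf vw; rewrite /act_kernel /= vw scale0r.
Qed.

Lemma induced_word_act (k : nat) (s : 'S_k) :
  induced_perm (perm (@word_act_inj n k s)).
Proof. by exists s => v; rewrite permE. Qed.

Lemma induced_unitaries_act (x : A) : induced_unitaries S x <->
  exists k (s : 'S_k), x = kernel_elt S (act_kernel s).
Proof.
split=> [[k [sigma [[s sE] ->]]]|[k [s ->]]].
  exists k, s; rewrite kernel_elt_act; apply: eq_bigr => v _.
  by rewrite sE permE.
exists k, (perm (@word_act_inj n k s)); split; first exact: induced_word_act.
exact: kernel_elt_act.
Qed.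

End Bogolyubov.

(** * Fixed points of Bogolyubov automorphisms and commutation with [lambda_u] *)

Section FixedPoints.
Variables (R : realType) (A : cstarAlgType R) (n : nat) (S : 'I_n -> A).
Local Notation C := R[i].
Hypothesis hC : cuntz_algebra S.
Let hS := cuntz_rel hC.

Definition bogolyubov_fixed (u : A) : Prop :=
  forall b : {lrmorphism A -> A}, bogolyubov S b -> b u = u.

Lemma induced_unitaries_fixed u : closed_lin_span (induced_unitaries S) u ->
  bogolyubov_fixed u.
Proof.
move=> uspan b /(bogolyubov_matrix hS) [a aU ab].
have span_fixed : forall x, lin_span (induced_unitaries S) x -> b x = x.
  apply: lin_span_min => [x /induced_unitaries_act [k [s ->]]||x y bx by_|c x bx].
  - by rewrite (implements_kernel ab); apply/eq_kernel_elt/conj_act_kernel.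
  - exact: rmorph0.
  - by rewrite rmorphD /= bx by_.
  - by rewrite linearZ /= bx.
apply/eqP; rewrite -subr_eq0; apply/eqP/norm_small2 => e e0.
have /closure_distP /(_ e e0) [x xspan ux] := uspan.
rewrite (le_trans (ler_distD x _ _)) // lerD //; last by rewrite distrC ltW.
rewrite -{1}(span_fixed x xspan) -rmorphB (le_trans _ (ltW ux)) //.
exact: star_morphism_contractive (proj1 ab).
Qed.

(** Each [b (S j)] is a combination of the [S i], so [lambda_u] multiplies it by [u], whereas
    [b (lambda_u (S j)) = b u * b (S j)]. As the [b (S j)] form a Cuntz family, [b u = u] is
    equivalent to agreement of the two composites on the generators. *)
Lemma commute_bogolyubov_fixed u (lambda_u : {lrmorphism A -> A}) :
  is_cuntz_endo S u lambda_u ->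
  (forall b : {lrmorphism A -> A}, bogolyubov S b ->
     forall x, lambda_u (b x) = b (lambda_u x)) <-> bogolyubov_fixed u.
Proof.
move=> [lS lE]; split=> h b bB; have [a aU [bS bE]] := bogolyubov_matrix hS bB.
  have lb j : lambda_u (b (S j)) = u * b (S j).
    rewrite bE linear_sum mulr_sumr; apply: eq_bigr => i _ /=.
    by rewrite linearZ /= lE -scalerAr.
  have key j : (b u - u) * b (S j) = 0.
    by rewrite mulrBl -lb h // lE rmorphM subrr.
  apply/eqP; rewrite -subr_eq0; apply/eqP.
  rewrite -[LHS]mulr1 -(rmorph1 b) -(proj2 hS) rmorph_sum mulr_sumr big1 //.
  by move=> j _; rewrite rmorphM /= mulrA key mul0r.
have bu : b u = u by apply: h.
(* Both composites send the generators to the Cuntz family [T], so uniqueness in the universal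
   property identifies them. *)
pose T j := b (lambda_u (S j)).
have famT : cuntz_family T.
  split=> [i|].
    by rewrite /T -bS -lS -!rmorphM (proj1 hS) !rmorph1.
  rewrite /T; under eq_bigr => i _ do rewrite -bS -lS -!rmorphM /=.
  by rewrite -!rmorph_sum (proj2 hS) !rmorph1.
have [f [_ _ fU]] := cuntz_univ hC famT.
have e1 := fU (lambda_u \o b : {lrmorphism A -> A}).
have e2 := fU (b \o lambda_u : {lrmorphism A -> A}).
move=> x; rewrite -[LHS]/((lambda_u \o b) x) -[RHS]/((b \o lambda_u) x).
rewrite e1 ?e2 //.
- by move=> y; rewrite /= lS bS.
- by move=> y; rewrite /= bS lS.
- move=> j; rewrite /T /= lE rmorphM /= bu bE linear_sum mulr_sumr.
  by apply: eq_bigr => i _ /=; rewrite linearZ /= lE -scalerAr.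
Qed.
End FixedPoints.

(** * Approximation of fixed points *)

Section Approximation.
Variables (R : realType) (A : cstarAlgType R) (n : nat) (S : 'I_n -> A).
Local Notation C := R[i].
Hypothesis hC : cuntz_algebra S.
Let hS := cuntz_rel hC.

(** The sum of truncated differences is the absolute value of the gauge degree of the monomial: only
    degree 0 and degrees beyond [d] are allowed. *)
Definition gapped_monomials (m d : nat) : set A :=
  [set x | exists s t, [/\ (size s <= m)%N, (size t <= m)%N,
     size s = size t \/ (d < (size s - size t) + (size t - size s))%N &
     x = word_elt S s * star (word_elt S t)]].

Lemma monomials_bounded x : lin_span (monomials S) x ->
  exists m, lin_span (gapped_monomials m 0) x.
Proof.
have mono m p : (m <= p)%N ->
    lin_span (gapped_monomials m 0) `<=` lin_span (gapped_monomials p 0).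
  move=> mp; apply: lin_span_sub => _ [s [t [sm tm st ->]]].
  apply: lin_span_gen; exists s, t.
  by split; rewrite ?(leq_trans sm) ?(leq_trans tm).
move: x; apply: lin_span_min => [_ [s [t ->]]||x y [m hx] [p hy]|c x [m hx]].
- exists (maxn (size s) (size t)); apply: lin_span_gen; exists s, t.
  split; rewrite ?leq_maxl ?leq_maxr //.
  by have [->|/eqP ne] := eqVneq (size s) (size t); [left|right; lia].
- by exists 0%N; apply: lin_span0.
- exists (maxn m p); apply: lin_spanD.
    exact: (mono _ _ (leq_maxl m p)) hx.
  exact: (mono _ _ (leq_maxr m p)) hy.
- by exists m; apply: lin_spanZ.
Qed.

(* Averaging over the gauge automorphism of a scalar [t] with [t^(d+1) = -1]
   kills the components of degree [d + 1] and [-(d + 1)]. *)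
Lemma widen_gap u m d e y : bogolyubov_fixed S u ->
  lin_span (gapped_monomials m d) y -> `|u - y| < e ->
  exists2 y', lin_span (gapped_monomials m d.+1) y' & `|u - y'| < e.
Proof.
move=> ufix yspan uy; pose t : C := d.+1.-root (-1).
have td : t ^+ d.+1 = -1 by rewrite rootCK.
have t1 : `|t| = 1.
  by apply/eqP; rewrite -(pexpr_eq1 (ltn0Sn d)) // -normrX td normrN1.
have tt : t * t^* = 1 by rewrite -normCK t1 expr1n.
have tU : (t%:M : 'M[C]_n) \is unitarymx.
  apply/unitarymxP; rewrite tr_scalar_mx map_scalar_mx -scalar_mxM /=.
  by rewrite tt.
have [b bB [bS bE]] := bogolyubov_exists hS hC tU.
have bw s : b (word_elt S s) = t ^+ size s *: word_elt S s.
  elim: s => [|j s IH]; first by rewrite /word_elt big_nil rmorph1 scale1r.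
  rewrite word_elt_cons rmorphM /= IH bE (bigD1 j) //= big1 ?addr0 => [|i].
    by rewrite mxE eqxx mulr1n -scalerAr -scalerAl scalerA exprSr.
  by move=> /negPf ij; rewrite mxE ij scale0r.
have L_span : forall x, lin_span (gapped_monomials m d) x ->
    lin_span (gapped_monomials m d.+1) (2^-1 *: (x + b x)).
  apply: lin_span_min => [_ [s [r [sm rm sr ->]]]||x z hx hz|c x hx].
  - rewrite rmorphM /= bS !bw starZ -scalerAl -scalerAr scalerA rmorphXn /=.
    rewrite -{1}[word_elt S s * _]scale1r -scalerDl scalerA.
    (* A monomial excluded by the wider gap has degree exactly [d + 1] or [-(d + 1)]; [b] multiplies
       it by -1, so it cancels in the mean. *)
    have [gap|/negP nogap] := boolP
        ((size s == size r) || (d.+1 < (size s - size r) + (size r - size s))%N).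
      apply/lin_spanZ/lin_span_gen; exists s, r; split=> //.
      by case/orP: gap => [/eqP ->|]; [left|right].
    have -> : t ^+ size s * t^* ^+ size r = -1.
      have [[E]|E] : (size s = size r + d.+1 \/ size r = size s + d.+1)%N by lia.
        by rewrite E exprD mulrAC -exprMn tt expr1n mul1r.
      rewrite E exprD mulrA -exprMn tt expr1n mul1r -rmorphXn td.
      by rewrite rmorphN rmorph1.
    by rewrite subrr mulr0 scale0r; apply: lin_span0.
  - by rewrite rmorph0 addr0 scaler0; apply: lin_span0.
  - by rewrite rmorphD addrACA scalerDr; apply: lin_spanD.
  - by rewrite linearZ /= -scalerDr scalerA mulrC -scalerA; apply: lin_spanZ.
exists (2^-1 *: (y + b y)); first exact: L_span.
have -> : u - 2^-1 *: (y + b y) = (2^-1 : C) *: ((u - y) + b (u - y)).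
  rewrite rmorphB /= ufix // addrACA -opprD scalerBr -mulr2n.
  by rewrite -[u *+ 2]scaler_nat scalerA mulVf // scale1r.
(* The distance to [u] does not grow, because [b] is contractive and fixes [u]. *)
rewrite normrZ ger0_norm ?invr_ge0 // -(ltr_pM2l (_ : 0 < 2)) // mulrA mulfV //.
rewrite mul1r (le_lt_trans (ler_normD _ _)) // mulr_natl mulr2n ltrD //.
by rewrite (le_lt_trans (star_morphism_contractive _ bS)).
Qed.

Lemma fixed_level_approx u e : bogolyubov_fixed S u -> 0 < e ->
  exists k (c : k.-tuple 'I_n * k.-tuple 'I_n -> C), `|u - kernel_elt S c| < e.
Proof.
move=> ufix e0.
have : closure (lin_span (monomials S)) u by rewrite monomials_dense.
move=> /closure_distP /(_ e e0) [y0 /monomials_bounded [m y0span] uy0].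
(* Words of length at most [m] cannot differ in length by more than [m + m], so this gap leaves only
   degree 0. *)
have [y yspan uy] : exists2 y, lin_span (gapped_monomials m (m + m)) y &
    `|u - y| < e.
  elim: (m + m)%N => [|d [y yspan uy]]; first by exists y0.
  exact: widen_gap uy.
suff [c yE] : level_elt S m y by exists m, c; rewrite -yE.
move: y yspan {uy}; apply: lin_span_min.
- move=> _ [s [t [sm tm st ->]]].
  by apply: (level_elt_raise hS (k := size s)) => //; lia.
- exact: level_elt0.
- exact: level_eltD.
- exact: level_eltZ.
Qed.

Lemma fixed_induced_unitaries u : bogolyubov_fixed S u ->
  closed_lin_span (induced_unitaries S) u.
Proof.
move=> ufix; apply/closure_distP => e e0.
have e20 : 0 < e / 2 by rewrite divr_gt0.
have [k [c0 /ltW uc0]] := fixed_level_approx ufix e20.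
(* The kernels within [e / 2] of [u] form a nonempty closed convex set. *)
pose K (c : k.-tuple 'I_n * k.-tuple 'I_n -> C) :=
  `|u - kernel_elt S c| <= e / 2.
have [||| c Kc cmin] := @min_norm_point R _ K.
- by exists c0.
- move=> c d Kc Kd; rewrite /K kernel_eltZ kernel_eltD.
  have -> : u - 2^-1 *: (kernel_elt S c + kernel_elt S d) =
      (2^-1 : C) *: ((u - kernel_elt S c) + (u - kernel_elt S d)).
    rewrite addrACA -opprD scalerBr -mulr2n.
    by rewrite -[u *+ 2]scaler_nat scalerA mulVf // scale1r.
  rewrite normrZ ger0_norm ?invr_ge0 // -(ler_pM2l (_ : 0 < 2)) // mulrA mulfV //.
  by rewrite mul1r (le_trans (ler_normD _ _)) // mulr_natl mulr2n lerD.
- move=> c Kc; apply/ler_addgt0Pr => e' e'0.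
  (* The tolerance is divided among the [N] coefficients; the successor keeps the denominator
     nonzero. *)
  pose N := #|{: k.-tuple 'I_n * k.-tuple 'I_n}|.
  have [|d Kd cd] := Kc (e' / N.+1%:R); first by rewrite divr_gt0 // ltr0n.
  rewrite -[_ - _](subrKA (kernel_elt S d)) (le_trans (ler_normD _ _)) // lerD //.
  rewrite -[kernel_elt S c]scale1r -scaleNr.
  rewrite -kernel_eltZ -kernel_eltD (le_trans (norm_kernel_elt hS _)) //.
  apply: (@le_trans _ _ (\sum_(p : k.-tuple 'I_n * k.-tuple 'I_n) e' / N.+1%:R)).
    by apply: ler_sum => p _; rewrite mulN1r distrC.
  rewrite sumr_const -/N -[_ *+ N]mulr_natr mulrAC ler_pdivrMr ?ltr0n //.
  by rewrite ler_wpM2l ?ltW // ltr_nat.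
(* Conjugation keeps [K] stable, since [b] is contractive and fixes [u], and preserves the
   Hilbert-Schmidt norm; uniqueness of the minimizer then makes [c] invariant. *)
have cfix : fixed_by_unitaries (fun v w => c (v, w)).
  move=> a aU; apply: conj_kernel_fixed_comm => //.
  have [b bB ab] := bogolyubov_exists hS hC aU.
  apply: cmin; last exact: sum_norm2_conj_kernel.
  rewrite /K -(implements_kernel ab) -{1}(ufix b bB) -rmorphB.
  exact: le_trans (star_morphism_contractive _ (proj1 ab)) Kc.
have [w wE] := schur_weyl cfix.
exists (kernel_elt S c); last first.
  by rewrite (le_lt_trans Kc) // ltr_pdivrMr // ltr_pMr // ltr1n.
have -> : kernel_elt S c = \sum_s w s *: kernel_elt S (act_kernel R (n := n) s).
  under [RHS]eq_bigr => s _ do rewrite scaler_sumr.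
  rewrite exchange_big /=; apply: eq_bigr => -[v x] _.
  rewrite wE scaler_suml; apply: eq_bigr => s _.
  by rewrite scalerA.
apply: lin_span_sum => s _; apply/lin_spanZ/lin_span_gen.
by apply/induced_unitaries_act; exists k, s.
Qed.
End Approximation.

Theorem theorem5p4 (R : realType) (n : nat) (A : cstarAlgType R)
    (S : 'I_n -> A) (u : A) (lambda_u : {lrmorphism A -> A})
    (hn : (2 <= n)%N) (hS : cuntz_algebra S)
    (hu : unitary u) (hlambda : is_cuntz_endo S u lambda_u) :
  (forall b : {lrmorphism A -> A}, bogolyubov S b ->
     forall x : A, lambda_u (b x) = b (lambda_u x))
  <-> closed_lin_span (induced_unitaries S) u.
Proof.
rewrite (commute_bogolyubov_fixed hS hlambda).
split; first exact: fixed_induced_unitaries.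
exact: induced_unitaries_fixed.
Qed.
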